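(* Let $P=P_a$ be the hNRMI with Lévy intensity $\rho(ds)\,aH(dx)$ (as in the context) and assume $\tilde{\tau}_1=\int_1^\infty s\,\rho(ds)<\infty$. As $a\to\infty$: (i) (Strong law of large numbers) $P\to H$ almost surely in $\mathbb{M}_{\mathbb{X}}$ with respect to the metric $d$, i.e. $d(P,H)\to0$ almost surely. (ii) (Glivenko–Cantelli) If $(\mathbb{X},\mathcal{X})=(\mathbb{R},\mathcal{B}(\mathbb{R}))$, then $\sup_{x\in\mathbb{R}}|P((-\infty,x])-H((-\infty,x])|\to0$ almost surely.
   Context: $(\mathbb{X},\mathcal{X})$ is a complete separable metric space (metric $\eta$) with its Borel $\sigma$-algebra. $\rho$ is a measure on $(0,\infty)$ with $\int_0^\infty\min(s,1)\rho(ds)<\infty$ and $\rho((0,\infty))=\infty$; $H$ is a non-atomic probability measure on $\mathbb{X}$; $a>0$. Realize all $a$ on one probability space: $N$ is a Poisson random measure on $[0,\infty)\times(0,\infty)\times\mathbb{X}$ with mean measure $d\zeta\,\rho(ds)H(dx)$, $\tilde{\mu}_a(A)=\int_0^a\int_0^\infty\int_A s\,N(d\zeta,ds,dx)$ (a completely random measure with Lévy intensity $\rho(ds)\,aH(dx)$), and $P(\cdot)=\tilde{\mu}_a(\cdot)/\tilde{\mu}_a(\mathbb{X})$. $\mathbb{M}_{\mathbb{X}}$ is the space of probability measures on $\mathbb{X}$ with the metric $d(\xi_1,\xi_2)=\sum_{i=1}^\infty 2^{-i}\big(|\int f_i\,d\xi_1-\int f_i\,d\xi_2|\wedge1\big)$,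 where $\{f_i\}_{i\ge1}$ is a countable dense subset of the space $C_b(\mathbb{X},\eta)$ of bounded continuous functions. *)

(* Defs.v *)
From mathcomp Require Import all_boot all_order all_algebra.
From mathcomp Require Import all_classical all_reals all_analysis measurable_realfun.
Set Implicit Arguments.
Unset Strict Implicit.
Unset Printing Implicit Defensive.
Import Order.TTheory GRing.Theory Num.Def Num.Theory.
Local Open Scope classical_set_scope.
Local Open Scope ring_scope.

Section hNRMI_defs.
Context {R : realType}.

Section metric.
Context {X : Type} (eta : X -> X -> R).

Definition is_metric : Prop :=
  [/\ (forall x y, 0 <= eta x y), (forall x y, eta x y = 0 <-> x = y),
      (forall x y, eta x y = eta y x) &
      (forall x y z, eta x z <= eta x y + eta y z)].

Definition metric_complete : Prop :=
  forall u : nat -> X,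
    (forall e, 0 < e -> exists N : nat, forall m n : nat,
        (N <= m)%N -> (N <= n)%N -> eta (u m) (u n) < e) ->
    exists l : X, forall e, 0 < e -> exists N : nat, forall n : nat,
        (N <= n)%N -> eta (u n) l < e.

Definition metric_separable : Prop :=
  exists u : nat -> X, forall x e, 0 < e -> exists n, eta x (u n) < e.

Definition metric_open (U : set X) : Prop :=
  forall x, U x -> exists2 e, 0 < e & [set y | eta x y < e] `<=` U.

Definition metric_continuous (f : X -> R) : Prop :=
  forall x e, 0 < e -> exists2 dl, 0 < dl &
    forall y, eta x y < dl -> `|f x - f y| < e.

Definition bounded_real_fun (f : X -> R) : Prop :=
  exists M : R, forall x, `|f x| <= M.
End metric.

Definition metric_borel (dX : measure_display) (X : measurableType dX)
    (eta : X -> X -> R) : Prop :=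
  @measurable _ X = <<s metric_open eta >>.

(* ---------- Levy measure rho on (0,oo), represented on R ------------------ *)
Definition levy_rho (rho : set R -> \bar R) : Prop :=
  [/\ rho [set` `]-oo, 0%R]] = 0%E,
      (\int[rho]_(s in `]0%R, +oo[) (minr s 1)%:E < +oo)%E &
      rho [set` `]0%R, +oo[] = +oo%E].

Definition poisson_law (m : R) (k : nat) : R :=
  expR (- m) * m ^+ k / (k`!)%:R.

Definition prm_mean {dX : measure_display} {X : measurableType dX}
    (rho : set R -> \bar R) (H : set X -> \bar R)
    (A : set (R * R * X)) : \bar R :=
  (\int[lebesgue_measure]_(z in `[0%R, +oo[)
     \int[rho]_(s in `]0%R, +oo[) \int[H]_x (\1_A (z, s, x))%:E)%E.

Definition is_poisson_random_measure {dO : measure_display}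
    {Omega : measurableType dO} (P0 : probability Omega R)
    {dT : measure_display} {T : measurableType dT}
    (N : Omega -> set T -> \bar R) (nu : set T -> \bar R) : Prop :=
  [/\ (forall w, [/\ N w set0 = 0%E,
                    (forall A, measurable A -> 0 <= N w A)%E &
                    semi_sigma_additive (N w)]),
      (forall A, measurable A -> measurable_fun setT (fun w => N w A)),
      (forall A, measurable A -> (nu A < +oo)%E -> forall k : nat,
          P0 [set w | N w A = (k%:R)%:E] = (poisson_law (fine (nu A)) k)%:E),
      (forall A, measurable A -> nu A = +oo%E ->
          P0 [set w | N w A = +oo%E] = 1%E) &
      (forall (n : nat) (A : 'I_n -> set T) (B : 'I_n -> set (\bar R)),
          (forall i, measurable (A i)) ->
          (forall i j, i != j -> A i `&` A j = set0) ->
          (forall i, measurable (B i)) ->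
          P0 (\bigcap_(i in [set: 'I_n]) [set w | B i (N w (A i))]) =
          (\prod_(i < n) P0 [set w | B i (N w (A i))])%E)].

Section hnrmi.
Context {dX : measure_display} {X : measurableType dX}.

Definition crm_tilde (Nw : set (R * R * X) -> \bar R) (a : R) (A : set X)
    : \bar R :=
  (\int[Nw]_(z in [set z : R * R * X | (0 <= z.1.1 <= a)%R /\ (0 < z.1.2)%R /\ A z.2])
     (z.1.2)%:E)%E.

Definition hnrmi (Nw : set (R * R * X) -> \bar R) (a : R) : set X -> \bar R :=
  fun A => (fine (crm_tilde Nw a A) / fine (crm_tilde Nw a setT))%:E.

(* d(xi1, xi2) = sum_{i >= 1} 2^-i (| int f_i dxi1 - int f_i dxi2 | /\ 1),
   the family being indexed from 0 here (f i plays the role of f_{i+1}) *)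
Definition dist_d (f : nat -> X -> R) (xi1 xi2 : set X -> \bar R) : \bar R :=
  (\sum_(i <oo)
     ((2 ^- i.+1 : R) *
      minr `| fine (\int[xi1]_x (f i x)%:E) - fine (\int[xi2]_x (f i x)%:E) | 1
     )%:E)%E.
End hnrmi.

End hNRMI_defs.

(* Main.v *)
(* Only the one-dimensional Poisson laws of N are used, never independence:
   applying the second moment of a Poisson variable to N (B `|` C) = N B + N C
   yields E[N B * N C] for disjoint B and C, hence the mean and the variance of
   every integral against N.  Fix A and th > 1, and write S a for
   crm_tilde N a A.  Discarding the jumps larger than th^k in S (th^k) costs a
   summable probability, because rho has a finite first moment; for the same
   reason Chebyshev's bounds for the truncated sums are summable in k, so
   Borel-Cantelli gives S (th^k) / th^k -> tau * H A with tau = int s rho(ds).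
   As S is nondecreasing, letting th decrease to 1 gives S a / a -> tau * H A,
   and dividing by the total mass gives P_a A -> H A, almost surely for
   countably many A at once.  For (i) take the superlevel sets of the f_i, whose
   indicators approximate f_i uniformly; for (ii) take the half-lines ending at
   the quantiles of H. *)
From HB Require Import structures.
Require Import Defs.
From mathcomp Require Import all_boot all_order all_algebra.
From mathcomp Require Import all_classical all_reals all_analysis measurable_realfun.
From mathcomp Require Import ring lra.
Import Order.TTheory GRing.Theory Num.Def Num.Theory.
Import numFieldNormedType.Exports HBNNSimple.
Local Open Scope classical_set_scope.
Local Open Scope ring_scope.

(** Time and truncation level are both [th ^+ k], so that for a fixed jump size [s] the two error
    series are geometric, with main term near the index where [th ^+ k] passes [s]. Tail
    probabilities give the sum of [th ^+ k] over [th ^+ k < s], Chebyshev gives the sum of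
    [s ^+ 2 / th ^+ k] over [s <= th ^+ k], and each is at most [th / (th - 1) * s]. Integrating
    against rho then costs one first moment, although rho may have an infinite second moment. The
    ratios [th] run through [1 + 1 / n.+1], a countable family, so one null set serves them all. The
    infinite mass of rho makes tau positive, which permits dividing by the total mass. A recurrent
    obstacle is that [N w] and [hnrmi (N w) a] are bare set functions, controlled on measurable sets
    only: they are replaced by genuine measures before integration theory is applied, and
    [hnrmi (N w) a] is shown to agree with a probability for almost every [w] and all large [a]. *)

Lemma sig_measure {R : realType} {d : measure_display} {T : measurableType d}
    (m : set T -> \bar R) :
  m set0 = 0%E -> (forall A, measurable A -> (0 <= m A)%E) ->
  semi_sigma_additive m ->
  {mu : {measure set T -> \bar R} | forall A, measurable A -> mu A = m A}.
Proof.
move=> m0 mge0 madd.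
(* A measure must be nonnegative on every set, whereas [m] is arbitrary off the sigma-algebra; hence
   the default value 0 there. *)
pose mu (A : set T) : \bar R := if `[< measurable A >] then m A else 0%E.
have mu0 : mu set0 = 0%E by rewrite /mu asboolT.
have muge0 A : (0 <= mu A)%E by rewrite /mu; case: ifPn => // /asboolP /mge0.
have muadd : semi_sigma_additive mu.
  move=> F mF tF mUF; rewrite /mu asboolT//.
  rewrite (_ : (fun n => _) = (fun n => \sum_(0 <= i < n) m (F i))%E).
    exact: madd.
  by apply/funext => n; apply: eq_bigr => i _; rewrite asboolT.
pose MU : {measure set T -> \bar R} :=
  HB.pack mu (isMeasure.Build _ _ _ mu mu0 muge0 muadd).
by exists MU => A mA; rewrite /= /mu asboolT.
Qed.

(** [sintegral] evaluates the set function only on level sets of simple functions, which are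
    measurable. This permits replacing [N w] by a measure inside [crm_tilde]. *)
Lemma eq_setfun_integral {R : realType} {d : measure_display}
    {T : measurableType d} (m1 m2 : set T -> \bar R) (D : set T)
    (f : T -> \bar R) :
  (forall A, measurable A -> m1 A = m2 A) ->
  (\int[m1]_(x in D) f x = \int[m2]_(x in D) f x)%E.
Proof.
move=> m12.
have E (h : {nnsfun T >-> R}) : sintegral m1 h = sintegral m2 h.
  rewrite /sintegral; apply: eq_fsbigr => x _; congr (_ * _)%E.
  exact: m12.
rewrite /integral; congr (ereal_sup _ - ereal_sup _)%E;
by apply/seteqP; split=> _ [h hf <-]; exists h => //; rewrite E.
Qed.

(** * Poisson moments *)

Lemma poisson_law_ge0 {R : realType} (l : R) k : 0 <= l -> 0 <= poisson_law l k.
Proof.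
by move=> l0; rewrite /poisson_law divr_ge0// mulr_ge0 ?expR_ge0 ?exprn_ge0.
Qed.

(** This recurrence shifts the index by one in the moment series, whose term at 0 vanishes. *)
Lemma poisson_lawS {R : realType} (l : R) k :
  k.+1%:R * poisson_law l k.+1 = l * poisson_law l k.
Proof.
rewrite /poisson_law factS natrM exprS invfM.
have : (k.+1%:R : R) != 0 by rewrite pnatr_eq0.
have : (k`!%:R : R) != 0 by rewrite pnatr_eq0 -lt0n fact_gt0.
move=> h1 h2; field; move: h2; rewrite -natr1 => h2; by rewrite h1 addrC h2.
Qed.

Lemma poisson_law_sum {R : realType} (l : R) : 0 <= l ->
  (\sum_(k <oo) (poisson_law l k)%:E = 1)%E.
Proof.
move=> l0.
rewrite [RHS](_ : _ = (expR (- l))%:E * (expR l)%:E)%E; last first.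
  by rewrite -EFinM expRN mulVf ?gt_eqF ?expR_gt0.
under eq_eseriesr => k _ do rewrite /poisson_law -mulrA EFinM.
rewrite nneseriesZl; last first.
  by move=> n _; rewrite lee_fin divr_ge0// exprn_ge0.
congr (_ * _)%E; rewrite expRE -EFin_lim; last first.
  rewrite /pseries/=; under eq_fun do rewrite mulrC.
  exact: is_cvg_series_exp_coeff.
apply/congr_lim/funext => n/=; rewrite /pseries/= /series/= -sumEFin//.
by under eq_bigr do rewrite mulrC.
Qed.

Lemma poisson_law_sum1 {R : realType} (l : R) : 0 <= l ->
  (\sum_(k <oo) (k%:R * poisson_law l k)%:E = l%:E)%E.
Proof.
move=> l0; rewrite nneseries_recl//; last first.
  by move=> k _; rewrite lee_fin mulr_ge0 ?poisson_law_ge0.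
rewrite mul0r add0e -(@nneseries_addn _ _ 1); last first.
  by move=> k; rewrite lee_fin mulr_ge0 ?poisson_law_ge0.
under eq_eseriesr => k _ do rewrite addn1 poisson_lawS EFinM.
rewrite nneseriesZl ?poisson_law_sum ?mule1// => k _.
by rewrite lee_fin poisson_law_ge0.
Qed.

Lemma poisson_law_sum2 {R : realType} (l : R) : 0 <= l ->
  (\sum_(k <oo) (k%:R * k%:R * poisson_law l k)%:E = (l + l * l)%:E)%E.
Proof.
move=> l0; rewrite nneseries_recl//; last first.
  by move=> k _; rewrite lee_fin mulr_ge0 ?poisson_law_ge0// mulr_ge0.
rewrite !mul0r add0e -(@nneseries_addn _ _ 1); last first.
  by move=> k; rewrite lee_fin mulr_ge0 ?poisson_law_ge0// mulr_ge0.
under eq_eseriesr => k _.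
  rewrite addn1 -mulrA poisson_lawS mulrCA EFinM -natr1 mulrDl mul1r EFinD.
  over.
rewrite nneseriesZl; last first.
  by move=> k _; rewrite lee_fin addr_ge0//; [apply: mulr_ge0 => //|]; exact: poisson_law_ge0.
rewrite nneseriesD; last 2 first.
- by move=> k _; rewrite lee_fin mulr_ge0 ?poisson_law_ge0.
- by move=> k _; rewrite lee_fin poisson_law_ge0.
rewrite poisson_law_sum1// poisson_law_sum// -EFinD -EFinM; congr _%:E; ring.
Qed.

Section poisson_moments.
Context {R : realType} {d : measure_display} {Omega : measurableType d}.
Variables (P : probability Omega R) (Y : Omega -> \bar R) (l : R).
Hypothesis mY : measurable_fun setT Y.
Hypothesis l0 : 0 <= l.
Hypothesis PY : forall k : nat,
  P [set w | Y w = k%:R%:E] = (poisson_law l k)%:E.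

(** The law prescribes only the masses of the integers. Since these sum to 1, all other values of
    [Y], [+oo] among them, are taken on a null set. *)
Lemma poisson_integral (phi : \bar R -> \bar R) :
  measurable_fun setT phi -> (forall x, (0 <= phi x)%E) ->
  (\int[P]_w phi (Y w) = \sum_(k <oo) (phi k%:R%:E * (poisson_law l k)%:E))%E.
Proof.
move=> mphi phi0.
pose E k := [set w | Y w = k%:R%:E].
have mE k : measurable (E k).
  rewrite (_ : E k = setT `&` Y @^-1` [set k%:R%:E])//; last by rewrite setTI.
  by apply: mY.
have tE : trivIset setT E.
  move=> i j _ _ [w []]; rewrite /E/= => -> /eqP.
  by rewrite eqe eqr_nat => /eqP.
have PE : P (\bigcup_k E k) = 1%E.
  rewrite measure_bigcup//.
  rewrite -[RHS](poisson_law_sum _ l0).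
  rewrite (eq_eseriesl (Q := xpredT)); last by move=> k; rewrite in_setT.
  by apply: eq_eseriesr => k _; rewrite -PY.
have mU : measurable (\bigcup_k E k) by exact: bigcup_measurable.
have PC : P (~` (\bigcup_k E k)) = 0%E by rewrite probability_setC// PE subee.
have mphiY : measurable_fun setT (fun w => phi (Y w)).
  exact: measurableT_comp.
rewrite (@ge0_negligible_integral _ _ _ P setT (~` (\bigcup_k E k)))//; last first.
  exact: measurableC.
rewrite setTD setCK ge0_integral_bigcup//; last exact: measurable_funTS.
apply: eq_eseriesr => k _.
rewrite (eq_integral (fun=> phi k%:R%:E)); last by move=> w /[!inE] ->.
rewrite integral_cst//; congr (_ * _)%E; exact: PY.
Qed.

Hypothesis Y0 : forall w, (0 <= Y w)%E.

Lemma poisson_mean : (\int[P]_w Y w = l%:E)%E.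
Proof.
(* [poisson_integral] wants a function that is nonnegative on all of [\bar R], hence the absolute
   value. *)
rewrite (eq_integral (fun w => `|Y w|%E)); last by move=> w _; rewrite gee0_abs.
rewrite (poisson_integral)//.
rewrite -[RHS](poisson_law_sum1 l l0); apply: eq_eseriesr => k _.
by rewrite gee0_abs// lee_fin.
Qed.

Lemma poisson_second_moment : (\int[P]_w (Y w * Y w) = (l + l * l)%:E)%E.
Proof.
rewrite (eq_integral (fun w => `|Y w| * `|Y w|)%E); last first.
  by move=> w _; rewrite gee0_abs.
rewrite (poisson_integral (fun y => `|y| * `|y|)%E); last 2 first.
- by apply: emeasurable_funM; exact: abse_measurable.
- by move=> x /=; rewrite mule_ge0.
rewrite -[RHS](poisson_law_sum2 l l0); apply: eq_eseriesr => k _.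
by rewrite gee0_abs ?lee_fin// -!EFinM.
Qed.

End poisson_moments.

(** * Integrals against a Poisson random measure *)

Section nnsfun_integral.
Context {R : realType} {d : measure_display} {S : measurableType d}.
Variables (mu : {measure set S -> \bar R}) (h : {nnsfun S >-> R}).

(** The value 0 is left out because its level set may have infinite mass, while the moment formulas
    concern sets of finite mass. *)
Definition nz_values : seq R := finmap.enum_fset (fset_set (range h `\ 0)).

Lemma nz_valuesP x : (x \in nz_values) = (x \in range h `\ 0).
Proof.
have fin : finite_set (range h `\ 0) by exact: finite_setD.
exact: in_fset_set.
Qed.

Lemma nz_values_gt0 x : x \in nz_values -> 0 < x.
Proof.
rewrite nz_valuesP inE => -[[z _ <-]] /= hz0.
by rewrite lt_neqAle fun_ge0 andbT eq_sym; apply/eqP.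
Qed.

Lemma nz_values_uniq : uniq nz_values.
Proof. exact: finmap.fset_uniq. Qed.

Lemma integral_comp_nnsfun (phi : R -> R) : phi 0 = 0 ->
  (forall x, 0 <= x -> 0 <= phi x) ->
  (\int[mu]_z (phi (h z))%:E =
   \sum_(x <- nz_values) (phi x)%:E * mu (h @^-1` [set x]))%E.
Proof.
move=> phi0 phi_ge0.
have mh x : measurable (h @^-1` [set x]) by exact: measurable_funPTI.
have E z : (phi (h z))%:E =
    (\sum_(x <- nz_values) (phi x)%:E * (\1_(h @^-1` [set x]) z)%:E)%E.
  have [hz0|hz0] := eqVneq (h z) 0.
    rewrite hz0 phi0 big_seq big1// => x xs.
    rewrite indicE memNset ?mule0//= => hzx.
    by have := nz_values_gt0 _ xs; rewrite -hzx hz0 ltxx.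
  rewrite (bigD1_seq (h z))/= ?nz_values_uniq//; last first.
    by rewrite nz_valuesP inE; split; [exists z|exact/eqP].
  rewrite indicE mem_set//= mule1 big1 ?adde0// => x xh.
  by rewrite indicE memNset ?mule0//= => /esym/eqP; exact/negP.
under eq_integral do rewrite E.
rewrite ge0_integral_sum//; last 2 first.
- move=> x; apply: measurable_funeM; apply/measurable_EFinP.
  exact: measurable_indic.
(* Nonnegativity is required for every real [x], not only for values of [h]; a negative [x] has an
   empty level set. *)
- move=> x z _ ; case: (boolP (0 <= x)) => x0.
    by rewrite mule_ge0// lee_fin// phi_ge0.
  rewrite indicE memNset ?mule0//= => hzx.
  by move: x0; rewrite -hzx fun_ge0.
rewrite big_seq [RHS]big_seq; apply: eq_bigr => x /nz_values_gt0 x0.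
rewrite ge0_integralZl_EFin//; last 2 first.
- by apply/measurable_EFinP; exact: measurable_indic.
- by rewrite phi_ge0// ltW.
by rewrite integral_indic ?setIT.
Qed.

End nnsfun_integral.

Section random_measure.
Context {R : realType} {d dS : measure_display} {Omega : measurableType d}
  {S : measurableType dS}.
Variables (P : probability Omega R) (M : Omega -> {measure set S -> \bar R})
  (kappa : {measure set S -> \bar R}).
Hypothesis mM : forall B, measurable B -> measurable_fun setT (M ^~ B).
Hypothesis mean_M : forall B, measurable B -> (kappa B < +oo)%E ->
  (\int[P]_w M w B = kappa B)%E.
Hypothesis sq_M : forall B, measurable B -> (kappa B < +oo)%E ->
  (\int[P]_w (M w B * M w B) = kappa B + kappa B * kappa B)%E.

(* Expanding the second moment of M (B `|` C) = M B + M C makes independence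
   of M B and M C unnecessary. *)
Lemma cross_moment (B C : set S) : measurable B -> measurable C ->
  (kappa B < +oo)%E -> (kappa C < +oo)%E -> B `&` C = set0 ->
  (\int[P]_w (M w B * M w C) = kappa B * kappa C)%E.
Proof.
move=> mB mC kB kC BC.
have mBC := measurableU _ _ mB mC.
have kU : (kappa (B `|` C) = kappa B + kappa C)%E by rewrite measureU.
have kBC : (kappa (B `|` C) < +oo)%E by rewrite kU lte_add_pinfty.
have mM2 : measurable_fun setT (fun w => M w B * M w C)%E.
  by apply: emeasurable_funM; exact: mM.
have := sq_M _ mBC kBC.
under eq_integral => w _.
  rewrite measureU// ge0_muleDl// !ge0_muleDr// (muleC (M w C) (M w B)).
  over.
have mBB : measurable_fun setT (fun w => M w B * M w B)%E.
  by apply: emeasurable_funM; exact: mM.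
have mCC : measurable_fun setT (fun w => M w C * M w C)%E.
  by apply: emeasurable_funM; exact: mM.
rewrite ge0_integralD//; last 4 first.
- by move=> w _; rewrite adde_ge0 ?mule_ge0.
- by apply: emeasurable_funD.
- by move=> w _; rewrite adde_ge0 ?mule_ge0.
- by apply: emeasurable_funD.
rewrite !ge0_integralD//; try by move=> w _; rewrite mule_ge0.
rewrite !sq_M// kU.
move: kB kC; rewrite -!ge0_fin_numE// => /fineK <- /fineK <-.
set b := fine _; set c := fine _.
have : (0 <= \int[P]_w (M w B * M w C))%E.
  by apply: integral_ge0 => w _; rewrite mule_ge0.
case: (\int[P]_w (M w B * M w C))%E => [x| |]//= _.
by move=> [] E; rewrite -EFinM; congr _%:E; lra.
Qed.

(** Squaring the sum over the values of [h] gives a double sum. Off the diagonal, level sets are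
    disjoint and the moments factor; a diagonal term has the extra summand [x ^+ 2 * kappa (A x)],
    and these add up to the integral of [h ^+ 2]. *)
Lemma nnsfun_moments (h : {nnsfun S >-> R}) :
  (\int[kappa]_z (h z)%:E < +oo)%E ->
  (\int[P]_w (\int[M w]_z (h z)%:E) = \int[kappa]_z (h z)%:E)%E /\
  (\int[P]_w ((\int[M w]_z (h z)%:E) * (\int[M w]_z (h z)%:E)) =
   \int[kappa]_z (h z ^+ 2)%:E +
   \int[kappa]_z (h z)%:E * \int[kappa]_z (h z)%:E)%E.
Proof.
move=> hfin.
set s := nz_values h.
pose A x := h @^-1` [set x].
have mA x : measurable (A x) by exact: measurable_funPTI.
have IE (mu : {measure set S -> \bar R}) :
    (\int[mu]_z (h z)%:E = \sum_(x <- s) `|x|%:E * mu (A x))%E.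
  rewrite -(integral_comp_nnsfun mu h normr)// ?normr0//.
  by apply: eq_integral => z _; rewrite ger0_norm.
(* A positive value contributes [x * kappa (A x)] to a finite integral, so its level set has finite
   mass. *)
have kA x : x \in s -> (kappa (A x) < +oo)%E.
  move=> xs; have x0 := nz_values_gt0 _ _ xs.
  have : (`|x|%:E * kappa (A x) < +oo)%E.
    apply: le_lt_trans hfin; rewrite IE (bigD1_seq x) ?nz_values_uniq//=.
    by rewrite leeDl// sume_ge0// => y _; rewrite mule_ge0// lee_fin.
  by rewrite gtr0_norm// -lte_pdivlMl// mulry gtr0_sg ?invr_gt0// mul1e.
have mterm x : measurable_fun setT (fun w => `|x|%:E * M w (A x))%E.
  by apply: measurable_funeM; exact: mM.
have term0 x w : (0 <= `|x|%:E * M w (A x))%E by rewrite mule_ge0// lee_fin.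
split.
  rewrite (eq_integral (fun w => \sum_(x <- s) `|x|%:E * M w (A x)))%E; last first.
    by move=> w _; rewrite IE.
  rewrite ge0_integral_sum// IE; apply: eq_big_seq => x xs.
  rewrite ge0_integralZl_EFin//; last exact: mM.
  by rewrite mean_M// kA.
rewrite (eq_integral (fun w => \sum_(x <- s) \sum_(y <- s)
    (`|x|%:E * M w (A x)) * (`|y|%:E * M w (A y))))%E; last first.
  move=> w _; rewrite IE ge0_sume_distrl//.
  by apply: eq_bigr => x _; rewrite ge0_sume_distrr.
rewrite ge0_integral_sum//; last 2 first.
- move=> x; apply: emeasurable_sum => y; exact: emeasurable_funM.
- by move=> x w _; apply: sume_ge0 => y _; rewrite mule_ge0.
have inner x : x \in s ->
    (\int[P]_w (\sum_(y <- s) (`|x|%:E * M w (A x)) * (`|y|%:E * M w (A y))) =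
     (x ^+ 2)%:E * kappa (A x) +
     \sum_(y <- s) (`|x|%:E * kappa (A x)) * (`|y|%:E * kappa (A y)))%E.
  move=> xs.
  rewrite ge0_integral_sum//; last by move=> y; exact: emeasurable_funM.
  have pair y : (\int[P]_w ((`|x|%:E * M w (A x)) * (`|y|%:E * M w (A y))) =
      `|x|%:E * `|y|%:E * \int[P]_w (M w (A x) * M w (A y)))%E.
    under eq_integral do rewrite muleACA.
    rewrite -EFinM ge0_integralZl_EFin//.
    by apply: emeasurable_funM; exact: mM.
  rewrite (bigD1_seq x) ?nz_values_uniq//= [in RHS](bigD1_seq x) ?nz_values_uniq//=.
  rewrite pair sq_M ?kA// ge0_muleDr// ?mule_ge0// -addeA; congr (_ + _)%E.
    by rewrite -EFinM -expr2 real_normK// num_real.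
  rewrite muleACA; congr (_ + _)%E.
  rewrite big_seq_cond [RHS]big_seq_cond; apply: eq_bigr => y /andP[ys yx].
  rewrite pair cross_moment ?kA//; last first.
    by apply/seteqP; split=> // z [hx hy]; move: yx; rewrite -hx -hy eqxx.
  by rewrite muleACA.
rewrite (eq_big_seq _ inner) big_split/= -(integral_comp_nnsfun kappa h (fun x => x ^+ 2)); last 2 first.
- by rewrite expr0n.
- by move=> x _; rewrite sqr_ge0.
congr (_ + _)%E; rewrite IE ge0_sume_distrl//.
by apply: eq_bigr => x _; rewrite ge0_sume_distrr.
Qed.

End random_measure.

(** Needed for the identity and for squaring; monotonicity is asked on nonnegative reals only so
    that squaring qualifies. *)
Lemma cvg_integral_nnsfun_approx {R : realType} {d : measure_display}
    {S : measurableType d} (mu : {measure set S -> \bar R}) (g : S -> R)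
    (mg : measurable_fun setT (EFin \o g)) (phi : R -> R) :
  (forall x, 0 <= g x) -> continuous phi ->
  (forall x y, 0 <= x -> x <= y -> phi x <= phi y) -> 0 <= phi 0 ->
  ((\int[mu]_z (phi (nnsfun_approx measurableT mg n z))%:E)%E @[n --> \oo]
    --> (\int[mu]_z (phi (g z))%:E)%E) /\
  nondecreasing_seq
    (fun n => \int[mu]_z (phi (nnsfun_approx measurableT mg n z))%:E)%E.
Proof.
move=> g0 cphi ndphi phi0.
have phi_ge0 x : 0 <= x -> 0 <= phi x.
  by move=> x0; rewrite (le_trans phi0)// ndphi.
have mphi : measurable_fun setT phi by exact: continuous_measurable_fun.
have mh n : measurable_fun setT
    (fun z => (phi (nnsfun_approx measurableT mg n z))%:E).
  by apply/measurable_EFinP; exact: measurableT_comp.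
have nd z : nondecreasing_seq
    (fun n => (phi (nnsfun_approx measurableT mg n z))%:E).
  move=> m n mn; rewrite lee_fin ndphi//.
  exact/lefP/nd_nnsfun_approx.
have lim z : ((phi (nnsfun_approx measurableT mg n z))%:E @[n --> \oo]
    --> (phi (g z))%:E)%E.
  apply: cvg_EFin; first by near=> n.
  have /fine_cvgP[_ +] := @cvg_nnsfun_approx _ _ _ _ measurableT _ mg
    (fun z _ => g0 z) z I.
  by move=> /cvg_comp; apply; exact: cphi.
split.
  rewrite [X in _ --> X](_ : _ = \int[mu]_z
      limn (fun n => (phi (nnsfun_approx measurableT mg n z))%:E))%E.
    by apply: cvg_monotone_convergence => // n z _; rewrite lee_fin phi_ge0.
  by apply: eq_integral => z _; apply/esym/cvg_lim.
move=> m n mn; apply: ge0_le_integral => //.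
- by move=> z _; rewrite lee_fin phi_ge0.
- by move=> z _; exact: nd.
Unshelve. all: by end_near. Qed.

Section random_measure.
Context {R : realType} {d dS : measure_display} {Omega : measurableType d}
  {S : measurableType dS}.
Variables (P : probability Omega R) (M : Omega -> {measure set S -> \bar R})
  (kappa : {measure set S -> \bar R}).
Hypothesis mM : forall B, measurable B -> measurable_fun setT (M ^~ B).
Hypothesis mean_M : forall B, measurable B -> (kappa B < +oo)%E ->
  (\int[P]_w M w B = kappa B)%E.
Hypothesis sq_M : forall B, measurable B -> (kappa B < +oo)%E ->
  (\int[P]_w (M w B * M w B) = kappa B + kappa B * kappa B)%E.
Variable g : S -> R.
Hypothesis mg : measurable_fun setT g.
Hypothesis g0 : forall z, 0 <= g z.

Let mgE : measurable_fun setT (EFin \o g).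
Proof. exact/measurable_EFinP. Qed.

Let h := nnsfun_approx measurableT mgE.

Let cvg1 (mu : {measure set S -> \bar R}) :
  ((\int[mu]_z (h n z)%:E)%E @[n --> \oo] --> (\int[mu]_z (g z)%:E)%E) /\
  nondecreasing_seq (fun n => \int[mu]_z (h n z)%:E)%E.
Proof. by apply: (cvg_integral_nnsfun_approx mu g mgE id) => // x; exact: cvg_id. Qed.

Let cvg2 (mu : {measure set S -> \bar R}) :
  (\int[mu]_z (h n z ^+ 2)%:E)%E @[n --> \oo] --> (\int[mu]_z (g z ^+ 2)%:E)%E.
Proof.
refine (proj1 (cvg_integral_nnsfun_approx mu g mgE (fun x => x ^+ 2) _ _ _ _)) => //.
- by move=> x; exact: exprn_continuous.
- by move=> x y x0 xy; rewrite ler_sqr ?nnegrE// (le_trans x0).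
Qed.

Let int_ge0 (mu : {measure set S -> \bar R}) n : (0 <= \int[mu]_z (h n z)%:E)%E.
Proof. by apply: integral_ge0 => z _; rewrite lee_fin. Qed.

Let intg_ge0 (mu : {measure set S -> \bar R}) : (0 <= \int[mu]_z (g z)%:E)%E.
Proof. by apply: integral_ge0 => z _; rewrite lee_fin. Qed.

Let mint n : measurable_fun setT (fun w => \int[M w]_z (h n z)%:E)%E.
Proof.
rewrite (_ : (fun w => _) = (fun w => \sum_(x <- nz_values (h n))
    `|x|%:E * M w (h n @^-1` [set x])))%E.
  apply: emeasurable_sum => x; apply: measurable_funeM; apply: mM.
  exact: measurable_funPTI.
apply/funext => w; rewrite -(integral_comp_nnsfun (M w) (h n) normr)// ?normr0//.
by apply: eq_integral => z _; rewrite ger0_norm.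
Qed.

Lemma measurable_integral_random_measure :
  measurable_fun setT (fun w => \int[M w]_z (g z)%:E)%E.
Proof.
apply: (emeasurable_fun_cvg (fun n w => \int[M w]_z (h n z)%:E)%E) => //.
by move=> w _; have [] := cvg1 (M w).
Qed.

Hypothesis gfin : (\int[kappa]_z (g z)%:E < +oo)%E.

Let hfin n : (\int[kappa]_z (h n z)%:E < +oo)%E.
Proof.
have [c nd] := cvg1 kappa; apply: le_lt_trans gfin.
rewrite -(cvg_lim _ c)//; apply: lime_ge; first by apply/cvg_ex; eexists; exact: c.
by near=> k; apply: nd; near: k; exact: nbhs_infty_ge.
Unshelve. all: by end_near. Qed.

(** Campbell's formula, by monotone convergence used under [kappa], under each [M w] and under
    [P]. *)
Lemma random_measure_mean :
  (\int[P]_w (\int[M w]_z (g z)%:E) = \int[kappa]_z (g z)%:E)%E.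
Proof.
have [c _] := cvg1 kappa.
rewrite -[RHS](cvg_lim _ c)//.
rewrite (eq_integral (fun w => limn (fun n => \int[M w]_z (h n z)%:E)))%E; last first.
  by move=> w _; have [cw _] := cvg1 (M w); apply/esym/cvg_lim.
rewrite monotone_convergence//.
  apply/congr_lim/funext => n.
  by have [-> _] := nnsfun_moments P M kappa mM mean_M sq_M (h n) (hfin n).
by move=> w _; have [] := cvg1 (M w).
Qed.

(** The variance of the integral is the integral of [g ^+ 2] against [kappa]. That integral may be
    infinite; finiteness of the mean keeps the limits of the product and of the sum well defined. *)
Lemma random_measure_second_moment :
  (\int[P]_w ((\int[M w]_z (g z)%:E) * (\int[M w]_z (g z)%:E)) =
   \int[kappa]_z (g z ^+ 2)%:E +
   \int[kappa]_z (g z)%:E * \int[kappa]_z (g z)%:E)%E.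
Proof.
have [c _] := cvg1 kappa.
have gfn : (\int[kappa]_z (g z)%:E)%E \is a fin_num by rewrite ge0_fin_numE.
have C : (\int[kappa]_z (h n z ^+ 2)%:E +
   \int[kappa]_z (h n z)%:E * \int[kappa]_z (h n z)%:E)%E @[n --> \oo] -->
   (\int[kappa]_z (g z ^+ 2)%:E +
   \int[kappa]_z (g z)%:E * \int[kappa]_z (g z)%:E)%E.
  apply: cvgeD; first 1 last.
  - exact: cvg2.
  - by apply: cvgeM => //; rewrite mule_def_fin.
  - by rewrite fin_num_adde_defl// fin_numM.
rewrite -[RHS](cvg_lim _ C)//.
rewrite (eq_integral (fun w => limn (fun n =>
    (\int[M w]_z (h n z)%:E) * (\int[M w]_z (h n z)%:E))))%E; last first.
  move=> w _; have [cw _] := cvg1 (M w); apply/esym/cvg_lim => //.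
  (* The integral against [M w] may be infinite, but both factors have the same limit, so the form
     [0 * oo] cannot occur. *)
  apply: cvgeM => //; rewrite /mule_def.
  by case: (\int[M w]_z (g z)%:E)%E.
rewrite monotone_convergence//.
- apply/congr_lim/funext => n.
  by have [_ ->] := nnsfun_moments P M kappa mM mean_M sq_M (h n) (hfin n).
- by move=> n; exact: emeasurable_funM.
- by move=> n w _; rewrite mule_ge0.
- by move=> w _ m n mn; have [_ nd] := cvg1 (M w); rewrite lee_pmul// nd.
Qed.

End random_measure.

(** * Chebyshev's inequality for nonnegative extended variables *)

Lemma chebyshev_ge0 {R : realType} {d : measure_display}
    {Omega : measurableType d} (P : probability Omega R) (Y : Omega -> \bar R)
    (m v t : R) :
  measurable_fun setT Y -> (forall w, (0 <= Y w)%E) ->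
  (\int[P]_w Y w = m%:E)%E -> (\int[P]_w (Y w * Y w) = (v + m * m)%:E)%E ->
  0 < t ->
  (P [set w | (t <= `|fine (Y w) - m|)%R] <= (t ^- 2 * v)%:E)%E.
Proof.
move=> mY Y0 EY EYY t0.
have m0 : 0 <= m by rewrite -lee_fin -EY; exact: integral_ge0.
have iY : P.-integrable setT Y.
  apply/integrableP; split => //.
  by under eq_integral do rewrite gee0_abs//; rewrite EY ltry.
have Yfin : {ae P, forall w, Y w \is a fin_num}.
  by have := integrable_ae measurableT iY; apply: filterS => w; exact.
pose Z w := fine (Y w).
have mZ : measurable_fun setT Z by exact: measurableT_comp.
have Z0 w : 0 <= Z w by exact: fine_ge0.
have EZ : (\int[P]_w (Z w)%:E = m%:E)%E.
  rewrite -EY; apply: ae_eq_integral => //; first exact/measurable_EFinP.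
  by apply: filterS Yfin => w /fineK.
have EZZ : (\int[P]_w (Z w * Z w)%:E = (v + m * m)%:E)%E.
  rewrite -EYY; apply: ae_eq_integral => //.
  - by apply/measurable_EFinP; exact: measurable_funM.
  - exact: emeasurable_funM.
  - by apply: filterS Yfin => w Yw _; rewrite EFinM /Z fineK.
have mZm : measurable_fun setT (fun w => ((Z w - m) ^+ 2)%:E).
  apply/measurable_EFinP; apply: measurable_funX.
  by apply: measurable_funB.
have mZZ : measurable_fun setT (fun w => (Z w * Z w)%:E).
  by apply/measurable_EFinP; exact: measurable_funM.
(* To avoid subtraction under the integral, [2 * m * Z] is added to the square: both sides become
   sums of nonnegative functions, and finiteness of the result allows solving for the variance. *)
have V : (\int[P]_w ((Z w - m) ^+ 2)%:E = v%:E)%E.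
  have : (\int[P]_w (((Z w - m) ^+ 2)%:E + (2 * m)%:E * (Z w)%:E) =
          \int[P]_w ((Z w * Z w)%:E + (m * m)%:E))%E.
    by apply: eq_integral => w _; rewrite -EFinM -!EFinD; congr _%:E; ring.
  rewrite ge0_integralD//; last 3 first.
  - by move=> w _; rewrite lee_fin sqr_ge0.
  - by move=> w _; rewrite mule_ge0// lee_fin// mulr_ge0.
  - by apply: measurable_funeM; exact/measurable_EFinP.
  rewrite ge0_integralD//; last 2 first.
  - by move=> w _; rewrite lee_fin mulr_ge0.
  - by move=> w _; rewrite lee_fin mulr_ge0.
  rewrite EZZ ge0_integralZl_EFin//; last 3 first.
  - by move=> w _; rewrite lee_fin.
  - exact/measurable_EFinP.
  - by rewrite mulr_ge0.
  have -> : (\int[P]_x (m * m)%:E = (m * m)%:E)%E.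
    rewrite integral_cst// -[RHS]mule1; congr (_ * _)%E.
    exact: probability_setT.
  rewrite EZ.
  have : (0 <= \int[P]_w ((Z w - m) ^+ 2)%:E)%E.
    by apply: integral_ge0 => w _; rewrite lee_fin sqr_ge0.
  case: (\int[P]_w ((Z w - m) ^+ 2)%:E)%E => [x| |]//= _ [] E.
  by congr _%:E; lra.
have t20 : 0 < t ^+ 2 by rewrite exprn_gt0.
have := @le_integral_abse _ _ _ P setT measurableT
  (fun w => ((Z w - m) ^+ 2)%:E) (t ^+ 2) mZm t20.
rewrite setTI (eq_integral (fun w => ((Z w - m) ^+ 2)%:E)%E); last first.
  by move=> w _ /=; rewrite ger0_norm ?sqr_ge0.
rewrite V => H; rewrite (EFinM (t ^- 2)) lee_pdivlMl//.
apply: le_trans H; rewrite le_eqVlt; apply/orP; left; apply/eqP.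
congr (_ * P _)%E; apply/seteqP.
have tZ w : (t ^+ 2 <= (Z w - m) ^+ 2) = (t <= `|Z w - m|).
  rewrite -[X in _ <= X]real_normK ?num_real//.
  by rewrite ler_sqr ?nnegrE// ltW.
by split => w /=; rewrite lee_fin (ger0_norm (sqr_ge0 _)) tZ.
Qed.

(** * Restriction, marginals, and the mean measure of rectangles *)

Lemma ge0_integral_mrestr {R : realType} {d : measure_display}
    {T : measurableType d} (mu : {measure set T -> \bar R}) (D : set T)
    (mD : measurable D) (f : T -> \bar R) :
  measurable_fun setT f -> (forall x, (0 <= f x)%E) ->
  (\int[mrestr mu mD]_x f x = \int[mu]_(x in D) f x)%E.
Proof.
move=> mf f0.
rewrite (@ge0_negligible_integral _ _ _ (mrestr mu mD) setT (~` D))//.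
- rewrite setTD setCK; apply: eq_measure_integral => A mA AD.
  by rewrite /= /mrestr (setIidl AD).
- exact: measurableC.
- by rewrite /= /mrestr setICl measure0.
Qed.

(** With [phi] the jump size and [D] the box of times up to [a] and locations in [A], this turns the
    measure behind [N w] into a measure on jump sizes alone. The sigma type lets one be picked for
    each [w]. *)
Lemma sig_marginal_measure {R : realType} {d d' : measure_display}
    {T : measurableType d} {S : measurableType d'} (phi : T -> S)
    (mu : {measure set T -> \bar R}) (D : set T) :
  measurable_fun setT phi -> measurable D ->
  {nu : {measure set S -> \bar R} |
    (forall B, measurable B -> nu B = mu (phi @^-1` B `&` D)) /\
    (forall g : S -> \bar R, measurable_fun setT g -> (forall x, (0 <= g x)%E) ->
      (\int[nu]_s g s = \int[mu]_(z in D) g (phi z))%E)}.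
Proof.
move=> mphi mD.
have mpre B : measurable B -> measurable (phi @^-1` B).
  by move=> mB; rewrite -[X in measurable X]setTI; exact: mphi.
have [| | |nu nuE] := @sig_measure R _ S (fun B => mu (phi @^-1` B `&` D)).
- by rewrite preimage_set0 set0I measure0.
- by [].
- move=> F mF tF mUF; rewrite preimage_bigcup setI_bigcupl.
  apply: measure_semi_sigma_additive.
  + by move=> i; apply: measurableI => //; exact: mpre.
  + apply/trivIsetP => i j _ _ ij.
    move/trivIsetP : tF => /(_ _ _ I I ij) Fij.
    by rewrite setIACA -preimage_setI Fij preimage_set0 set0I.
  + by apply: bigcup_measurable => i _; apply: measurableI => //; exact: mpre.
exists nu; split=> // g mg g0.
rewrite (eq_setfun_integral nu (pushforward (mrestr mu mD) phi))//.
rewrite ge0_integral_pushforward// preimage_setT.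
by rewrite ge0_integral_mrestr//; [exact: measurableT_comp|move=> x /=].
Qed.

Lemma prm_mean_rectangle {R : realType} {dX : measure_display}
    {X : measurableType dX} (rho : {measure set R -> \bar R})
    (H : probability X R) (a : R) (B : set R) (A : set X) :
  0 <= a -> measurable B -> measurable A ->
  prm_mean rho H (([set` `[0, a]] `*` B) `*` A) =
  ((a * fine (H A))%:E * rho (B `&` [set` `]0%R, +oo[]))%E.
Proof.
move=> a0 mB mA; rewrite /prm_mean.
have HA : H A \is a fin_num by exact: fin_num_measure.
have H0 : 0 <= fine (H A) by exact: fine_ge0.
transitivity (\int[lebesgue_measure]_(z in `[0%R, +oo[)
   ((\1_[set` `[0, a]] z)%:E * ((fine (H A))%:E * rho (B `&` [set` `]0%R, +oo[]))))%E.
  apply: eq_integral => z _.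
  transitivity (\int[rho]_(s in `]0%R, +oo[)
     (((\1_[set` `[0, a]] z * fine (H A))%:E) * (\1_B s)%:E))%E.
    apply: eq_integral => s _.
    transitivity (\int[H]_x ((\1_[set` `[0, a]] z * \1_B s)%:E * (\1_A x)%:E))%E.
      apply: eq_integral => x _; rewrite -EFinM; congr _%:E.
      by rewrite !indicE !in_setX/= -!natrM !mulnb.
    rewrite ge0_integralZl_EFin//; last first.
      by apply/measurable_EFinP; exact: measurable_indic.
    rewrite integral_indic// setIT -[X in (_ * X)%E]fineK// -!EFinM.
    by congr _%:E; ring.
  rewrite ge0_integralZl_EFin//; last 2 first.
  - by apply/measurable_EFinP; exact: measurable_indic.
  - by rewrite mulr_ge0.
  by rewrite integral_indic// EFinM muleA.
rewrite ge0_integralZr//; last 2 first.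
- by apply/measurable_EFinP; exact: measurable_indic.
- by rewrite mule_ge0// lee_fin.
rewrite integral_indic// EFinM -muleA; congr (_ * _)%E.
rewrite setIidl; last by move=> x /=; rewrite !in_itv/= andbT => /andP[].
transitivity (@lebesgue_measure R [set` `[0, a]]); first by [].
by rewrite lebesgue_measure_itv/= lte_fin; case: ltP => [_|];
  [rewrite oppr0 adde0|move=> a0'; congr _%:E; apply/eqP; rewrite eq_le a0 a0'].
Qed.

(** * Law of large numbers for the completely random measure *)

(** The absolute value makes the function nonnegative on the whole line, as the integration lemmas
    want; on positive jumps it is [s] cut to 0 above [c]. *)
Definition trunc_id {R : realType} (c s : R) : R := `|s| * \1_[set` `]-oo, c]] s.

Lemma trunc_id_ge0 {R : realType} (c s : R) : 0 <= trunc_id c s.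
Proof. by rewrite /trunc_id mulr_ge0// indicE. Qed.

Lemma measurable_trunc_id {R : realType} (c : R) :
  measurable_fun setT (trunc_id c).
Proof. by apply: measurable_funM => //; exact: measurable_indic. Qed.

Lemma trunc_id_le {R : realType} (c s : R) : trunc_id c s <= `|s|.
Proof. by rewrite /trunc_id ler_piMr// indicE; case: (_ \in _). Qed.

Lemma trunc_idE {R : realType} (c s : R) : s <= c -> trunc_id c s = `|s|.
Proof. by move=> sc; rewrite /trunc_id indicE mem_set/= ?mulr1// in_itv. Qed.

Lemma trunc_id0 {R : realType} (c s : R) : c < s -> trunc_id c s = 0.
Proof.
by move=> cs; rewrite /trunc_id indicE memNset/= ?mulr0// in_itv/= leNgt cs.
Qed.

Section levy.
Context {R : realType}.
Variable rho : {measure set R -> \bar R}.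
Hypothesis rhoL : levy_rho rho.
Hypothesis rho1 : (\int[rho]_(s in `[1%R, +oo[) s%:E < +oo)%E.

(** For [s > 0], [s] is at most [minr s 1] plus [s] restricted to [s >= 1]; the two parts are the
    Levy condition and the tail moment. *)
Lemma levy_first_moment : (\int[rho]_(s in `]0%R, +oo[) `|s|%:E < +oo)%E.
Proof.
have [_ rmin _] := rhoL.
pose D0 : set R := [set` `]0%R, +oo[].
have mmin : measurable_fun D0 (fun s : R => (minr s 1)%:E).
  by apply/measurable_EFinP; apply: measurable_minr.
have mid : measurable_fun D0 (fun s : R => (s%:E * (\1_[set` `[1%R, +oo[] s)%:E))%E.
  by apply/measurable_EFinP; apply: measurable_funM => //; apply: measurable_funTS.
apply: (@le_lt_trans _ _ (\int[rho]_(s in `]0%R, +oo[) ((minr s 1)%:E + s%:E * (\1_[set` `[1%R, +oo[] s)%:E))%E).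
  apply: ge0_le_integral => //.
  - by apply/measurable_EFinP; apply: measurable_funTS; exact: normr_measurable.
  - exact: emeasurable_funD.
  - move=> s; rewrite /= in_itv/= andbT => s0; rewrite gtr0_norm// indicE.
    rewrite -EFinM -EFinD lee_fin; case: (leP 1 s) => s1.
      by rewrite mem_set/= ?in_itv/= ?s1// mulr1 lerDr.
    by rewrite memNset ?mulr0 ?addr0//= in_itv/= andbT; apply/negP; rewrite -ltNge.
rewrite ge0_integralD//; last 2 first.
- by move=> s; rewrite /= in_itv/= andbT => s0; rewrite lee_fin le_min ltW/=.
- move=> s; rewrite /= in_itv/= andbT => s0.
  by rewrite mule_ge0// ?lee_fin ?indicE// ltW.
rewrite lte_add_pinfty//; apply: le_lt_trans rho1.
rewrite le_eqVlt; apply/orP; left; apply/eqP.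
rewrite [RHS]integral_mkcond [LHS]integral_mkcond; apply: eq_integral => s _.
rewrite !patchE indicE; case: (leP 1 s) => s1.
  by rewrite !mem_set/= ?in_itv/= ?s1 ?mule1// (lt_le_trans _ s1).
rewrite [in RHS]memNset/= ?in_itv/= ?andbT; last by apply/negP; rewrite -ltNge.
rewrite (memNset (A := [set` `[1, +oo[])) ?mule0 ?if_same//=.
by rewrite in_itv/= andbT; apply/negP; rewrite -ltNge.
Qed.

End levy.

(** * Borel-Cantelli, geometric sums, and passage from geometric to real times *)

Lemma borel_cantelli_ae {R : realType} {d : measure_display}
    {T : measurableType d} (mu : {measure set T -> \bar R}) (E : (set T)^nat) :
  (forall k, measurable (E k)) -> (\sum_(k <oo) mu (E k) < +oo)%E ->
  {ae mu, forall w, \forall k \near \oo, ~ E k w}.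
Proof.
move=> mE sE; exists (lim_sup_set E); split.
- by apply: bigcap_measurable => // k _; exact: bigcup_measurable.
- exact: lim_sup_set_cvg0.
move=> w /= nearE n _; apply: contrapT => nE; apply: nearE.
by exists n => // k /= nk Ek; apply: nE; exists k.
Qed.

Lemma sum_geo_trunc {R : realType} (th s : R) (n : nat) : 1 < th -> 0 < s ->
  \sum_(0 <= k < n) (th ^- k * trunc_id (th ^+ k) s ^+ 2) <= th / (th - 1) * s.
Proof.
move=> th1 s0; have th0 : 0 < th by rewrite (lt_trans _ th1).
have thn k : 0 < th ^+ k by rewrite exprn_gt0.
(* The sum telescopes: (1 - th^-1) times the k-th term is at most T k - T k.+1. *)
pose T k := Num.min s (s ^+ 2 * th ^- k).
suff H : (1 - th^-1) * \sum_(0 <= k < n) (th ^- k * trunc_id (th ^+ k) s ^+ 2)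
    <= s - T n.
  have T0 : 0 <= T n.
    by rewrite le_min ltW//= mulr_ge0 ?sqr_ge0// invr_ge0 ltW.
  have c0 : 0 < 1 - th^-1 by rewrite subr_gt0 invf_lt1.
  have -> : th / (th - 1) = (1 - th^-1)^-1.
    have th10 : th - 1 != 0 by rewrite subr_eq0 gt_eqF.
    have thn0 : th != 0 by rewrite gt_eqF.
    by field; rewrite th10 thn0.
  by rewrite ler_pdivlMl// (le_trans H)// gerBl.
elim: n => [|n IH].
  by rewrite big_geq// mulr0 subr_ge0 ge_min lexx.
rewrite big_nat_recr//= mulrDr.
have step : (1 - th^-1) * (th ^- n * trunc_id (th ^+ n) s ^+ 2) <= T n - T n.+1.
  have [sn|ns] := leP s (th ^+ n).
    have TE k : (n <= k)%N -> T k = s ^+ 2 * th ^- k.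
      move=> nk; apply/min_idPr.
      rewrite ler_pdivrMr// expr2 ler_pM2l// (le_trans sn)//.
      by rewrite ler_weXn2l// ltW.
    rewrite !TE// trunc_idE// gtr0_norm// (exprSr th n) invfM.
    by rewrite le_eqVlt; apply/orP; left; apply/eqP; ring.
  rewrite trunc_id0// expr0n mulr0 mulr0 subr_ge0 /T le_min ge_min lexx/=.
  rewrite ge_min; apply/orP; right; rewrite ler_pM2l ?exprn_gt0//.
  by rewrite lef_pV2 ?posrE// ler_weXn2l// ltW.
by rewrite (le_trans (lerD IH step))//; rewrite le_eqVlt; apply/orP; left; apply/eqP; ring.
Qed.

Lemma sum_geo_tail {R : realType} (th s : R) (n : nat) : 1 < th -> 0 < s ->
  \sum_(0 <= k < n) (th ^+ k * \1_[set` `]th ^+ k, +oo[] s) <= th / (th - 1) * s.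
Proof.
move=> th1 s0; have th0 : 0 < th by rewrite (lt_trans _ th1).
have thn k : 0 < th ^+ k by rewrite exprn_gt0.
(* The sum telescopes: (th - 1) times the k-th term is at most U k.+1 - U k. *)
pose U k := Num.min (th * s) (th ^+ k).
suff H : (th - 1) * \sum_(0 <= k < n) (th ^+ k * \1_[set` `]th ^+ k, +oo[] s)
    <= U n.
  rewrite mulrAC ler_pdivlMr ?subr_gt0// mulrC (le_trans H)//.
  by rewrite ge_min lexx.
elim: n => [|n IH].
  by rewrite big_geq// mulr0 le_min expr0 ler01 mulr_ge0// ltW.
rewrite big_nat_recr//= mulrDr.
have step : (th - 1) * (th ^+ n * \1_[set` `]th ^+ n, +oo[] s) <= U n.+1 - U n.
  have [ns|sn] := ltP (th ^+ n) s.
    rewrite indicE mem_set/= ?in_itv/= ?ns// mulr1.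
    have UE : U n.+1 = th ^+ n.+1.
      by apply/min_idPr; rewrite exprS ler_pM2l// ltW.
    rewrite UE lerBrDr addrC -lerBrDr exprS.
    rewrite (_ : th * th ^+ n - _ = th ^+ n); last by ring.
    by rewrite ge_min lexx orbT.
  rewrite indicE memNset/= ?mulr0 ?subr_ge0 ?in_itv/= ?andbT; last first.
    by apply/negP; rewrite -leNgt.
  rewrite /U le_min ge_min lexx/= ge_min; apply/orP; right.
  by rewrite ler_weXn2l// ltW.
by rewrite (le_trans (lerD IH step))// addrC subrK.
Qed.

Lemma nneseries_le_bound {R : realType} (u : nat -> \bar R) (b : \bar R) :
  (forall k, (0 <= u k)%E) ->
  (forall n, (\sum_(0 <= k < n) u k <= b)%E) -> (\sum_(k <oo) u k <= b)%E.
Proof.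
move=> u0 ub; apply: lime_le; first exact: is_cvg_nneseries.
exact: nearW.
Qed.

Lemma near_le_expr {R : realType} (th b : R) : 1 < th ->
  \forall k \near \oo, b <= th ^+ k.
Proof.
move=> th1; have d0 : 0 < th - 1 by rewrite subr_gt0.
have bern k : 1 + k%:R * (th - 1) <= th ^+ k.
  elim: k => [|k IH]; first by rewrite mul0r addr0 expr0.
  rewrite exprS (le_trans _ (ler_wpM2l _ IH))//; last by rewrite ltW// (lt_trans _ th1).
  rewrite -natr1.
  have : 0 <= k%:R * (th - 1) * (th - 1) by rewrite !mulr_ge0// ltW.
  by set x := k%:R; lra.
near=> k; apply: le_trans (bern k).
have : b / (th - 1) <= k%:R.
  by near: k; exact: nbhs_infty_ger.
by rewrite ler_pdivrMr// => /le_trans; apply; rewrite lerDr.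
Unshelve. all: by end_near. Qed.

Lemma exists_expr_floor {R : realType} (th a : R) : 1 < th -> 1 <= a ->
  exists k, th ^+ k <= a < th ^+ k.+1.
Proof.
move=> th1 a1.
have ex : exists k, a < th ^+ k.
  have [K _ /(_ K (leqnn K)) aK] := near_le_expr th (a + 1) th1.
  by exists K; rewrite (lt_le_trans _ aK)// ltrDl.
have [k ak kmin] := ex_minnP ex; case: k => [|k] in ak kmin *.
  by move: ak; rewrite expr0 ltNge a1.
exists k; rewrite ak andbT leNgt; apply/negP => /kmin.
by rewrite ltnn.
Qed.

Lemma cvg_monotone_interpolation {R : realType} (S : R -> \bar R) (L : R) :
  (forall a, (0 <= S a)%E) -> (forall a b, a <= b -> (S a <= S b)%E) ->
  (forall n : nat, let th : R := 1 + n.+1%:R^-1 in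
    (\forall k \near \oo, S (th ^+ k) \is a fin_num) /\
    (fine (S (th ^+ k)) / th ^+ k @[k --> \oo] --> L)) ->
  (forall a, S a \is a fin_num) /\ (fine (S a) / a @[a --> +oo] --> L).
Proof.
move=> S0 Snd SL.
have th1 n : 1 < 1 + n.+1%:R^-1 :> R by rewrite ltrDl invr_gt0.
have Sfin a : S a \is a fin_num.
  (* Powers of 2 ([n = 0]) exceed any [a], so eventual finiteness along them and monotonicity give
     finiteness everywhere. *)
  have [fin0 _] := SL 0%N.
  have [k [ak fink]] : exists k, a <= (1 + 1%:R^-1 : R) ^+ k /\ S ((1 + 1%:R^-1) ^+ k) \is a fin_num.
    by near \oo => k; exists k; split; near: k => //; exact: near_le_expr.
  rewrite ge0_fin_numE// (le_lt_trans (Snd _ _ ak))//.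
  by rewrite -ge0_fin_numE.
split => //.
have fnd a b : a <= b -> fine (S a) <= fine (S b).
  by move=> ab; rewrite fine_le// Snd.
have f0 a : 0 <= fine (S a) by rewrite fine_ge0.
have L0 : 0 <= L.
  have [_ c] := SL 0%N; rewrite -(cvg_lim _ c)//; apply: limr_ge.
    by apply/cvg_ex; eexists; exact: c.
  by apply: nearW => k; rewrite divr_ge0// exprn_ge0// ltW// (lt_trans _ (th1 0%N)).
apply/cvgrPdist_le => e e0.
(* With this [n], [L * (th - 1) <= e / 2]. As [th <= 2], the upper bound [th * (L + e / 4)] is at
   most [L + e]. For the lower bound, a quotient [y < L] satisfies [th * y <= y + e / 2], while
   [th * y] is at least [L - e / 4]. *)
pose n := Num.bound (2 * L / e).
pose th : R := 1 + n.+1%:R^-1.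
have thn1 : 1 < th by exact: th1.
have th0 : 0 < th by rewrite (lt_trans _ thn1).
have th2 : th <= 2.
  by rewrite /th -[leRHS]/(1 + 1) lerD2l invf_le1// ler1n.
have Lth : L * (th - 1) <= e / 2.
  rewrite /th addrAC subrr add0r ler_pdivrMr//.
  have : 2 * L / e < n.+1%:R.
    rewrite (lt_le_trans (archi_boundP _)) ?ler_nat//.
    by rewrite divr_ge0 ?mulr_ge0// ltW.
  rewrite ltr_pdivrMr// => /ltW.
  by set x := n.+1%:R; lra.
have [_ /cvgrPdist_le/(_ (e / 4))] := SL n.
rewrite -/th => /(_ _)[|K _ HK]; first by rewrite divr_gt0.
near=> a.
have a1 : 1 <= a by near: a; apply: nbhs_pinfty_ge; exact: num_real.
have a0 : 0 < a by rewrite (lt_le_trans _ a1).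
have [k /andP[ka ak]] := exists_expr_floor th a thn1 a1.
have Kk : (K <= k)%N.
  rewrite leqNgt; apply/negP => kK.
  have : th ^+ K <= a by near: a; apply: nbhs_pinfty_ge; exact: num_real.
  rewrite leNgt (lt_le_trans ak)//.
  by rewrite ler_weXn2l// ltW.
have tk0 j : 0 < th ^+ j by rewrite exprn_gt0.
have := HK k Kk; have := HK k.+1 (leqW Kk).
set u := fine (S (th ^+ k.+1)) / _; set l := fine (S (th ^+ k)) / _.
rewrite !ler_norml => /andP[u1 u2] /andP[l1 l2].
have up : fine (S a) / a <= th * u.
  have -> : th * u = fine (S (th ^+ k.+1)) / th ^+ k.
    by rewrite /u exprS; field; rewrite !gt_eqF.
  rewrite ler_pM ?invr_ge0 ?(ltW a0)//; first by rewrite fnd// ltW.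
  by rewrite lef_pV2 ?posrE.
have lo : l / th <= fine (S a) / a.
  rewrite /l -mulrA -invfM -exprSr ler_pM ?invr_ge0 ?(ltW (tk0 _))//; first by rewrite fnd.
  by rewrite lef_pV2 ?posrE// ltW.
have lo' : l <= th * (fine (S a) / a) by rewrite mulrC -ler_pdivrMr.
set y := fine (S a) / a in up lo' *.
have y0 : 0 <= y by rewrite divr_ge0// ltW.
apply/andP; split; last first.
  nra.
nra.
Unshelve. all: by end_near. Qed.

(** * Strong laws for [crm_tilde] and [hnrmi] *)

Section poisson_random_measure.
Context {R : realType} {dO : measure_display} {Omega : measurableType dO}.
Variable P0 : probability Omega R.
Context {dX : measure_display} {X : measurableType dX}.
Variables (rho : {measure set R -> \bar R}) (H : probability X R).
Variable N : Omega -> set (R * R * X) -> \bar R.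
Hypothesis rhoL : levy_rho rho.
Hypothesis rho1 : (\int[rho]_(s in `[1%R, +oo[) s%:E < +oo)%E.
Hypothesis prmN : is_poisson_random_measure P0 N (prm_mean rho H).

Lemma prm_sig_measure (w : Omega) : {mu : {measure set (R * R * X) -> \bar R} |
  forall A, measurable A -> mu A = N w A}.
Proof.
by have [/(_ w)[N0 Nge0 Nadd] _ _ _ _] := prmN; exact: sig_measure.
Qed.

Definition crm_domain (a : R) (A : set X) : set (R * R * X) :=
  ([set` `[0, a]] `*` [set` `]0%R, +oo[]) `*` A.

Lemma measurable_crm_domain a (A : set X) :
  measurable A -> measurable (crm_domain a A).
Proof. by move=> mA; apply: measurableX => //; apply: measurableX. Qed.

Lemma crm_tildeE w (mu : {measure set (R * R * X) -> \bar R}) a A :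
  (forall B, measurable B -> mu B = N w B) ->
  (crm_tilde (N w) a A = \int[mu]_(z in crm_domain a A) `|z.1.2|%:E)%E.
Proof.
move=> muN; rewrite /crm_tilde.
rewrite -(eq_setfun_integral mu (N w))//.
rewrite (_ : [set z | _] = crm_domain a A); last first.
  apply/seteqP; split => [[[z s] x]|[[z s] x]] /=; rewrite /crm_domain/= !in_itv/= ?andbT.
    by move=> [? [? ?]].
  by move=> [[? ?] ?].
apply: eq_integral => -[[z s] x]; rewrite inE => -[[_ /=]].
by rewrite in_itv/= andbT => s0 _; rewrite gtr0_norm.
Qed.

(** All that the limit theorem has to know about truncation at [c]: a variable with computable mean
    and variance, and an exceptional event outside of which it is the untruncated mass. *)
Lemma crm_truncation (A : set X) (a c : R) : measurable A -> 0 < a -> 0 < c ->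
  let m := (a * fine (H A)) *
    fine (\int[rho]_(s in `]0%R, +oo[) (trunc_id c s)%:E)%E in
  let v := (a * fine (H A)) *
    fine (\int[rho]_(s in `]0%R, +oo[) (trunc_id c s ^+ 2)%:E)%E in
  exists (Y : Omega -> \bar R) (E : set Omega),
  [/\ measurable_fun setT Y, (forall w, (0 <= Y w)%E),
      (\int[P0]_w Y w = m%:E)%E, (\int[P0]_w (Y w * Y w) = (v + m * m)%:E)%E &
      [/\ measurable E,
          (P0 E <= (a * fine (H A))%:E * rho [set` `]c, +oo[])%E &
          forall w, ~ E w -> crm_tilde (N w) a A = Y w]].
Proof.
move=> mA a0 c0 m v.
have [_ mN poisN _ _] := prmN.
pose Nm w := projT1 (prm_sig_measure w).
have NmE w B : measurable B -> Nm w B = N w B.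
  by move=> mB; rewrite /Nm; case: prm_sig_measure => mu /= ->.
have mD := measurable_crm_domain a A mA.
pose phi (z : R * R * X) : R := z.1.2.
have mphi : measurable_fun setT phi.
  apply: (measurableT_comp (f := snd)) => //.
(* [M w B] counts the jumps with time in [[0, a]], location in [A] and positive size in [B]. *)
pose M w := projT1 (sig_marginal_measure phi (Nm w) (crm_domain a A) mphi mD).
have ME w (B : set R) : measurable B -> M w B =
    N w (([set` `[0, a]] `*` (B `&` [set` `]0%R, +oo[])) `*` A).
  move=> mB; rewrite /M; case: sig_marginal_measure => nu /= [-> // _].
  rewrite NmE.
    congr (N w _); apply/seteqP; split => [[[z s] x]|[[z s] x]] /=; rewrite /crm_domain/=.
      by move=> [? [[? ?] ?]].
    by move=> [[? [? ?]] ?].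
  apply: measurableI => //.
  by rewrite -[X in measurable X]setTI; exact (mphi measurableT _ mB).
have MI w (g : R -> R) : measurable_fun setT g -> (forall s, 0 <= g s) ->
   (\int[M w]_s (g s)%:E = \int[Nm w]_(z in crm_domain a A) (g z.1.2)%:E)%E.
  move=> mg g0; rewrite /M; case: sig_marginal_measure => nu /= [_ ->]//.
  exact/measurable_EFinP.
have ah0 : 0 <= a * fine (H A) by rewrite mulr_ge0 ?fine_ge0// ltW.
have mpos : measurable ([set` `]0%R, +oo[] : set R) by [].
(* By [prm_mean_rectangle] this is the mean measure of [M]. *)
pose kappa : {measure set R -> \bar R} :=
  mscale (NngNum ah0) (mrestr rho mpos).
have mrect (B : set R) : measurable B ->
    measurable (([set` `[0, a]] `*` (B `&` [set` `]0%R, +oo[])) `*` A).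
  move=> mB; apply: measurableX => //; apply: measurableX => //.
  exact: measurableI.
have kE (B : set R) : measurable B -> kappa B =
    prm_mean rho H (([set` `[0, a]] `*` (B `&` [set` `]0%R, +oo[])) `*` A).
  move=> mB; rewrite prm_mean_rectangle ?ltW//; last exact: measurableI.
  by rewrite -setIA setIid.
have mM (B : set R) : measurable B -> measurable_fun setT (M ^~ B).
  move=> mB; rewrite (_ : M ^~ B = fun w => N w
    (([set` `[0, a]] `*` (B `&` [set` `]0%R, +oo[])) `*` A)).
    exact: mN (mrect _ mB).
  by apply/funext => w; rewrite ME.
have law (B : set R) : measurable B -> (kappa B < +oo)%E -> forall k : nat,
    P0 [set w | M w B = k%:R%:E] = (poisson_law (fine (kappa B)) k)%:E.
  move=> mB kB k; rewrite kE// in kB *; rewrite -(poisN _ (mrect _ mB) kB).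
  by congr (P0 _); apply/seteqP; split => w /=; rewrite ME.
have kfin (B : set R) : measurable B -> (kappa B < +oo)%E -> kappa B = (fine (kappa B))%:E.
  by move=> mB kB; rewrite fineK// ge0_fin_numE.
have mean_M (B : set R) : measurable B -> (kappa B < +oo)%E ->
    (\int[P0]_w M w B = kappa B)%E.
  move=> mB kB; rewrite kfin//; apply: poisson_mean => //; first exact: mM.
  exact: law.
have sq_M (B : set R) : measurable B -> (kappa B < +oo)%E ->
    (\int[P0]_w (M w B * M w B) = kappa B + kappa B * kappa B)%E.
  move=> mB kB; rewrite kfin// -EFinM -EFinD.
  apply: poisson_second_moment => //; first exact: mM.
  exact: law.
have kI (g : R -> R) : measurable_fun setT g -> (forall s, 0 <= g s) ->
    (\int[kappa]_s (g s)%:E =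
     (a * fine (H A))%:E * \int[rho]_(s in `]0%R, +oo[) (g s)%:E)%E.
  move=> mg g0; have mgE : measurable_fun setT (fun s => (g s)%:E).
    exact/measurable_EFinP.
  rewrite /kappa ge0_integral_mscale//; last by move=> s _; rewrite lee_fin.
  by congr (_ * _)%E; rewrite -(ge0_integral_mrestr rho _ mpos).
have mg := measurable_trunc_id c.
have g0 := trunc_id_ge0 c.
have mu_fin : (\int[rho]_(s in `]0%R, +oo[) (trunc_id c s)%:E < +oo)%E.
  apply: le_lt_trans (levy_first_moment rho rhoL rho1).
  apply: ge0_le_integral => //.
  - by move=> s _; rewrite lee_fin.
  - by apply: measurable_funTS; exact/measurable_EFinP.
  - apply/measurable_EFinP; apply: measurable_funTS; exact: normr_measurable.
  - by move=> s _; rewrite lee_fin trunc_id_le.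
(* For [s > 0], [trunc_id c s ^+ 2 <= c * trunc_id c s], so the first moment already bounds the
   truncated second moment. *)
have v_fin : (\int[rho]_(s in `]0%R, +oo[) (trunc_id c s ^+ 2)%:E < +oo)%E.
  apply: (@le_lt_trans _ _ (\int[rho]_(s in `]0%R, +oo[) (c%:E * (trunc_id c s)%:E))%E).
    apply: ge0_le_integral => //.
    - by move=> s _; rewrite lee_fin sqr_ge0.
    - apply: measurable_funTS; apply/measurable_EFinP; exact: measurable_funX.
    - apply: measurable_funTS; apply/measurable_EFinP; exact: measurable_funM.
    - move=> s; rewrite /= in_itv/= andbT => s0; rewrite -EFinM lee_fin.
      have [sc|cs] := leP s c; last by rewrite trunc_id0// mulr0 expr0n.
      by rewrite trunc_idE// gtr0_norm// expr2 ler_pM2r.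
  rewrite ge0_integralZl_EFin//; last 3 first.
  - by move=> s _; rewrite lee_fin.
  - by apply: measurable_funTS; exact/measurable_EFinP.
  - exact: ltW.
  by rewrite lte_mul_pinfty// ?lee_fin ?ltW.
have mE_ : (\int[kappa]_s (trunc_id c s)%:E = m%:E)%E.
  rewrite kI// /m (EFinM (a * _)) fineK// ge0_fin_numE//.
  by apply: integral_ge0 => s _; rewrite lee_fin.
have vE_ : (\int[kappa]_s (trunc_id c s ^+ 2)%:E = v%:E)%E.
  rewrite kI//; last 2 first.
  - exact: measurable_funX.
  - by move=> s; rewrite sqr_ge0.
  rewrite /v (EFinM (a * _)) fineK// ge0_fin_numE//.
  by apply: integral_ge0 => s _; rewrite lee_fin sqr_ge0.
have kgfin : (\int[kappa]_s (trunc_id c s)%:E < +oo)%E by rewrite mE_ ltry.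
(* Off [E] no jump is larger than [c], so truncation changes nothing. *)
pose E := [set w | M w [set` `]c, +oo[] <> 0%E].
have mc : measurable ([set` `]c, +oo[] : set R) by [].
exists (fun w => \int[M w]_s (trunc_id c s)%:E)%E, E; split.
- exact: measurable_integral_random_measure.
- by move=> w; apply: integral_ge0 => s _; rewrite lee_fin.
- by rewrite -mE_; exact: random_measure_mean.
- by rewrite EFinD (EFinM m) -mE_ -vE_; exact: random_measure_second_moment.
have mE : measurable E.
  rewrite (_ : E = setT `&` (M ^~ [set` `]c, +oo[]) @^-1` (~` [set 0%E])); last first.
    by rewrite setTI.
  by apply: (mM _ mc) => //; exact: measurableC.
have kc : kappa [set` `]c, +oo[] =
    ((a * fine (H A))%:E * rho [set` `]c, +oo[])%E.
  rewrite /kappa /= /mscale /= /mrestr setIidl//.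
  by move=> s /=; rewrite !in_itv/= !andbT; exact: lt_trans.
split => //.
(* P(M > 0) = 1 - exp (- kappa) <= kappa *)
- rewrite -kc; have [kfc|] := ltP (kappa [set` `]c, +oo[]) +oo%E; last first.
    by rewrite leye_eq => /eqP ->; rewrite leey.
  have PE0 : P0 (~` E) = (expR (- fine (kappa [set` `]c, +oo[])))%:E.
    have := law _ mc kfc 0%N; rewrite /poisson_law expr0 mulr1 fact0 divr1 => <-.
    congr (P0 _); apply/seteqP; split => w; rewrite /E/=; first exact: contrapT.
    by move=> -> [].
  rewrite -[E]setCK probability_setC ?PE0; last exact: measurableC.
  rewrite [leRHS]kfin// -EFinB lee_fin lerBlDr.
  by rewrite -lerBlDl; exact: expR_ge1Dx.
- move=> w /contrapT Mc0; rewrite (crm_tildeE w (Nm w))//; last exact: NmE.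
  rewrite -(MI w normr)//.
  have mn : measurable_fun [set: R] (fun s : R => `|s|%:E).
    by apply/measurable_EFinP; exact: normr_measurable.
  have mge : measurable_fun [set: R] (fun s : R => (trunc_id c s)%:E).
    exact/measurable_EFinP.
  rewrite (@ge0_negligible_integral _ _ _ (M w) setT [set` `]c, +oo[])//.
  rewrite [RHS](@ge0_negligible_integral _ _ _ (M w) setT [set` `]c, +oo[])//.
    apply: eq_integral => s; rewrite inE => -[_ /negP]; rewrite in_itv/= andbT -leNgt => sc.
    by rewrite trunc_idE.
  by move=> s _; rewrite lee_fin.
Qed.

(** Exchanging series and integral turns a pointwise bound linear in [s] into a multiple of the
    first moment of rho. Both Borel-Cantelli arguments rest on this. *)
Lemma sum_levy_bound (u : nat -> \bar R) (q : nat -> R -> R) (K C : R) :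
  0 <= K -> 0 <= C -> (forall k, measurable_fun setT (q k)) ->
  (forall k s, 0 <= q k s) ->
  (forall n s, 0 < s -> \sum_(0 <= k < n) q k s <= C * s) ->
  (forall k, (0 <= u k)%E) ->
  (forall k, (u k <= K%:E * \int[rho]_(s in `]0%R, +oo[) (q k s)%:E)%E) ->
  (\sum_(k <oo) u k < +oo)%E.
Proof.
move=> K0 C0 mq q0 qC u0 uq.
have mqE k (D : set R) : measurable_fun D (fun s => (q k s)%:E).
  by apply: measurable_funTS; exact/measurable_EFinP.
have mn (D : set R) : measurable_fun D (fun s : R => `|s|%:E).
  by apply: measurable_funTS; apply/measurable_EFinP; exact: normr_measurable.
have bound : ((K * C)%:E * \int[rho]_(s in `]0%R, +oo[) `|s|%:E < +oo)%E.
  by rewrite lte_mul_pinfty ?lee_fin ?mulr_ge0//; exact: levy_first_moment.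
apply: le_lt_trans bound; apply: nneseries_le_bound => // n.
apply: (@le_trans _ _ (\sum_(0 <= k < n)
    K%:E * \int[rho]_(s in `]0%R, +oo[) (q k s)%:E)%E); first exact: lee_sum.
rewrite -ge0_sume_distrr; last first.
  by move=> k _; apply: integral_ge0 => s _; rewrite lee_fin.
rewrite EFinM -muleA lee_wpmul2l ?lee_fin//.
rewrite -ge0_integral_sum//; last by move=> k s _; rewrite lee_fin.
rewrite -ge0_integralZl_EFin//.
apply: ge0_le_integral => //.
- by move=> s _; apply: sume_ge0 => k _; rewrite lee_fin.
- exact: emeasurable_sum.
- by apply: measurable_funeM.
move=> s; rewrite /= in_itv/= andbT => s0.
by rewrite sumEFin -EFinM lee_fin gtr0_norm// qC.
Qed.

Let tau := fine (\int[rho]_(s in `]0%R, +oo[) `|s|%:E)%E.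

Lemma cvg_trunc_moment (th : R) : 1 < th ->
  fine (\int[rho]_(s in `]0%R, +oo[) (trunc_id (th ^+ k) s)%:E)%E
    @[k --> \oo] --> tau.
Proof.
move=> th1.
have mt k (D : set R) : measurable_fun D (fun s => (trunc_id (th ^+ k) s)%:E).
  apply: measurable_funTS; apply/measurable_EFinP; exact: measurable_trunc_id.
suff : (\int[rho]_(s in `]0%R, +oo[) (trunc_id (th ^+ k) s)%:E @[k --> \oo] -->
    tau%:E)%E by move=> /fine_cvgP[_].
rewrite /tau fineK; last first.
  rewrite ge0_fin_numE; first exact: levy_first_moment.
  by apply: integral_ge0 => s _; rewrite lee_fin.
rewrite [X in _ --> X](_ : _ = \int[rho]_(s in `]0%R, +oo[)
    limn (fun k => (trunc_id (th ^+ k) s)%:E))%E; last first.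
  apply: eq_integral => s _; apply/esym/cvg_lim => //.
  apply: cvg_near_cst.
  by apply: filterS (near_le_expr th s th1) => k sk; rewrite trunc_idE.
apply: cvg_monotone_convergence => //.
- by move=> k s _; rewrite lee_fin trunc_id_ge0.
- move=> s _ i j ij; rewrite lee_fin.
  have [si|si] := leP s (th ^+ i); last by rewrite (trunc_id0 _ s si) trunc_id_ge0.
  by rewrite !trunc_idE// (le_trans si)// ler_weXn2l// ltW.
Qed.

Lemma lln_geometric (th : R) (A : set X) : 1 < th -> measurable A ->
  {ae P0, forall w,
    (\forall k \near \oo, crm_tilde (N w) (th ^+ k) A \is a fin_num) /\
    (fine (crm_tilde (N w) (th ^+ k) A) / th ^+ k @[k --> \oo] -->
      fine (H A) * tau)}.
Proof.
move=> th1 mA; have th0 : 0 < th by rewrite (lt_trans _ th1).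
have thn k : 0 < th ^+ k by rewrite exprn_gt0.
set h := fine (H A).
have h0 : 0 <= h by exact: fine_ge0.
pose mu k := fine (\int[rho]_(s in `]0%R, +oo[) (trunc_id (th ^+ k) s)%:E)%E.
pose vv k := fine (\int[rho]_(s in `]0%R, +oo[) (trunc_id (th ^+ k) s ^+ 2)%:E)%E.
have /choice[YE YEP] : forall k, exists p : (Omega -> \bar R) * set Omega,
  [/\ measurable_fun setT p.1, (forall w, (0 <= p.1 w)%E),
      (\int[P0]_w p.1 w = (th ^+ k * h * mu k)%:E)%E,
      (\int[P0]_w (p.1 w * p.1 w) =
        (th ^+ k * h * vv k + (th ^+ k * h * mu k) * (th ^+ k * h * mu k))%:E)%E &
      [/\ measurable p.2,
          (P0 p.2 <= (th ^+ k * h)%:E * rho [set` `](th ^+ k)%R, +oo[])%E &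
          forall w, ~ p.2 w -> crm_tilde (N w) (th ^+ k) A = p.1 w]].
  move=> k; have [Y [E YE]] := crm_truncation A _ _ mA (thn k) (thn k).
  by exists (Y, E).
pose Y k := (YE k).1; pose E k := (YE k).2.
pose C := th / (th - 1).
have C0 : 0 <= C by rewrite divr_ge0 ?ltW// subr_gt0.
have BC1 : {ae P0, forall w, \forall k \near \oo, ~ E k w}.
  apply: borel_cantelli_ae; first by move=> k; have [_ _ _ _ []] := YEP k.
  apply: (sum_levy_bound _ (fun k (s : R) => th ^+ k * \1_[set` `]th ^+ k, +oo[] s) h C) => //.
  - by move=> k; apply: measurable_funM => //; exact: measurable_indic.
  - by move=> k s; apply: mulr_ge0 => //; exact: ltW.
  - by move=> n s s0; exact: sum_geo_tail.
  move=> k; have [_ _ _ _ [_ PE _]] := YEP k; apply: le_trans PE _.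
  rewrite mulrC EFinM -muleA lee_wpmul2l ?lee_fin//.
  rewrite (eq_integral (fun s => (th ^+ k)%:E * (\1_[set` `]th ^+ k, +oo[] s)%:E)%E)//.
  rewrite ge0_integralZl_EFin//; last 2 first.
  - by apply/measurable_EFinP; exact: measurable_indic.
  - exact: ltW.
  rewrite integral_indic// setIidl// => s /=; rewrite !in_itv/= !andbT.
  exact: lt_trans.
(* Tolerances are restricted to [1 / p.+1] so that a single null set covers all of them. *)
have BC2 : {ae P0, forall w, forall p : nat, \forall k \near \oo,
    `|fine (Y k w) - th ^+ k * h * mu k| < p.+1%:R^-1 * th ^+ k}.
  apply/ae_foralln => p; pose eta : R := p.+1%:R^-1.
  have eta0 : 0 < eta by rewrite invr_gt0.
  pose F k := [set w | eta * th ^+ k <= `|fine (Y k w) - th ^+ k * h * mu k|].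
  suff : {ae P0, forall w, \forall k \near \oo, ~ F k w}.
    apply: filterS => w; apply: filterS => k; rewrite /F/= => /negP.
    by rewrite -ltNge.
  have mY k : measurable_fun setT (Y k) by have [] := YEP k.
  have mF k : measurable (F k).
    rewrite (_ : F k = setT `&` (fun w => `|fine (Y k w) - th ^+ k * h * mu k|)
      @^-1` [set` `[eta * th ^+ k, +oo[]); last first.
      by rewrite setTI; apply/seteqP; split => w; rewrite /F/= in_itv/= andbT.
    have : measurable_fun setT (fun w => `|fine (Y k w) - th ^+ k * h * mu k|).
      apply: measurableT_comp => //; apply: measurable_funB => //.
      exact: measurableT_comp.
    by move=> mf; exact: mf.
  apply: borel_cantelli_ae => //.
  have tk0 k : 0 < eta * th ^+ k by rewrite mulr_gt0.
  (* Chebyshev at deviation [eta * th ^+ k] with variance [th ^+ k * h * vv k] leaves [eta ^- 2 * h]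
     times [th ^- k * vv k]. *)
  apply: (sum_levy_bound _ (fun k (s : R) => th ^- k * trunc_id (th ^+ k) s ^+ 2)
    (eta ^- 2 * h) C) => //.
  - by rewrite mulr_ge0// invr_ge0 exprn_ge0// ltW.
  - move=> k; apply: measurable_funM => //; apply: measurable_funX.
    exact: measurable_trunc_id.
  - by move=> k s; rewrite mulr_ge0 ?sqr_ge0// invr_ge0 ltW.
  - by move=> n s s0; exact: sum_geo_trunc.
  move=> k; have [? ? ? ? _] := YEP k.
  apply: (le_trans (chebyshev_ge0 P0 (Y k) _ (th ^+ k * h * vv k) _ _ _ _ _ (tk0 k))) => //.
  have mt : measurable_fun [set: R] (fun s : R => (trunc_id (th ^+ k) s ^+ 2)%:E).
    apply/measurable_EFinP; apply: measurable_funX; exact: measurable_trunc_id.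
  rewrite (eq_integral (fun s => (th ^- k)%:E * (trunc_id (th ^+ k) s ^+ 2)%:E)%E)//.
  rewrite ge0_integralZl_EFin//; last 3 first.
  - by move=> s _; rewrite lee_fin sqr_ge0.
  - exact: measurable_funTS.
  - by rewrite invr_ge0 ltW.
  set I := (\int[rho]_(s in `]0%R, +oo[) (trunc_id (th ^+ k) s ^+ 2)%:E)%E.
  (* An inequality suffices and holds even for infinite [I], since [fine] sends [+oo] to 0. *)
  have vI : ((vv k)%:E <= I)%E.
    have : (0 <= I)%E by apply: integral_ge0 => s _; rewrite lee_fin sqr_ge0.
    by rewrite /vv -/I; case: I => // r _; exact: leey.
  rewrite muleA -EFinM; apply: (@le_trans _ _ ((eta ^- 2 * h * th ^- k)%:E * (vv k)%:E)%E).
    rewrite -EFinM lee_fin le_eqVlt; apply/orP; left; apply/eqP.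
    have := lt0r_neq0 (thn k); have := lt0r_neq0 eta0.
    by move=> e0 t0; field; rewrite e0 t0.
  by rewrite lee_wpmul2l// lee_fin !mulr_ge0// invr_ge0 ?exprn_ge0// ltW.
(* The deviation bound concerns [fine (Y k w)], which reads [+oo] as 0; the finite mean excludes
   that value almost surely. *)
have Yfin : {ae P0, forall w, forall k, Y k w \is a fin_num}.
  apply/ae_foralln => k; have [mY Y0 EY _ _] := YEP k.
  have iY : P0.-integrable setT (Y k).
    apply/integrableP; split => //.
    rewrite (eq_integral (Y k)); last by move=> w _; rewrite gee0_abs//; exact: Y0.
    by rewrite (_ : integral _ _ _ = (th ^+ k * h * mu k)%:E) ?ltry.
  by have := integrable_ae measurableT iY; apply: filterS => w; exact.
have cmu := cvg_trunc_moment th th1.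
apply: filterS3 BC1 BC2 Yfin => w w1 w2 w3.
have crmE : \forall k \near \oo, crm_tilde (N w) (th ^+ k) A = Y k w.
  by apply: filterS w1 => k; have [_ _ _ _ [_ _ +]] := YEP k; apply.
split; first by apply: filterS crmE => k ->.
apply/cvgrPdist_lt => e e0.
have e20 : 0 < e / 2 by rewrite divr_gt0.
(* [h] may be 0, so [h + 1] serves as the denominator. *)
have h1 : 0 < h + 1 by rewrite ltr_wpDl.
near=> k.
have -> : crm_tilde (N w) (th ^+ k) A = Y k w by near: k.
have muk : `|tau - mu k| < e / 2 / (h + 1).
  by near: k; move/cvgrPdist_lt : cmu; apply; rewrite divr_gt0.
pose p := Num.bound (2 / e).
have pe : p.+1%:R^-1 <= e / 2.
  rewrite -[leRHS]invrK lef_pV2 ?posrE ?invr_gt0// invfM invrK mulrC.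
  apply/ltW; apply: (lt_le_trans (archi_boundP _)); first by rewrite divr_ge0// ltW.
  by rewrite ler_nat.
have Yk : `|fine (Y k w) - th ^+ k * h * mu k| < p.+1%:R^-1 * th ^+ k.
  by near: k; exact: w2.
have tk := thn k.
have D1 : `|h * tau - h * mu k| <= e / 2.
  rewrite -mulrBr normrM ger0_norm//.
  have : (h + 1) * `|tau - mu k| < e / 2 by rewrite mulrC -ltr_pdivlMr.
  by move=> /ltW; apply: le_trans; rewrite ler_wpM2r// lerDl.
have D2 : `|h * mu k - fine (Y k w) / th ^+ k| < e / 2.
  apply: lt_le_trans pe; rewrite distrC.
  rewrite (_ : _ - _ = (fine (Y k w) - th ^+ k * h * mu k) / th ^+ k); last first.
    by field; exact: lt0r_neq0.
  by rewrite normrM normfV (gtr0_norm tk) ltr_pdivrMr.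
rewrite (_ : h * tau - _ = (h * tau - h * mu k) + (h * mu k - fine (Y k w) / th ^+ k)); last first.
  by ring.
rewrite (le_lt_trans (ler_normD _ _))//.
by rewrite [ltRHS]splitr ler_ltD.
Unshelve. all: by end_near. Qed.

Definition jump_size (z : R * R * X) : \bar R := `|z.1.2|%:E.

Lemma measurable_jump_size : measurable_fun setT jump_size.
Proof.
apply/measurable_EFinP; apply: measurableT_comp => //.
by apply: (measurableT_comp (f := snd)).
Qed.

Lemma jump_size_ge0 z : (0 <= jump_size z)%E.
Proof. by rewrite lee_fin. Qed.

Lemma crm_tilde_ge0 w a (A : set X) : (0 <= crm_tilde (N w) a A)%E.
Proof.
have [mu muE] := prm_sig_measure w.
rewrite (crm_tildeE w mu)//.
by apply: integral_ge0 => z _; exact: jump_size_ge0.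
Qed.

Lemma crm_tilde_le w a b (A : set X) : measurable A -> a <= b ->
  (crm_tilde (N w) a A <= crm_tilde (N w) b A)%E.
Proof.
move=> mA ab; have [mu muE] := prm_sig_measure w.
rewrite !(crm_tildeE w mu)//.
apply: ge0_subset_integral.
- exact: measurable_crm_domain.
- exact: measurable_crm_domain.
- by apply: measurable_funTS; exact: measurable_jump_size.
- by move=> z _; exact: jump_size_ge0.
- move=> [[z s] x]; rewrite /crm_domain/= !in_itv/= => -[[/andP[z0 za] s0] Ax].
  by split=> //; split=> //; rewrite z0 (le_trans za).
Qed.

Lemma crm_tilde_sig_measure w a : {nu : {measure set X -> \bar R} |
  forall A, measurable A -> nu A = crm_tilde (N w) a A}.
Proof.
have [mu muE] := prm_sig_measure w.
apply: sig_measure.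
- rewrite (crm_tildeE w mu)// (_ : crm_domain a set0 = set0) ?integral_set0//.
  by apply/seteqP; split => // -[z x] [].
- by move=> A mA; exact: crm_tilde_ge0.
move=> F mF tF mUF.
rewrite (crm_tildeE w mu)//.
rewrite (_ : (fun n => _) = (fun n => \sum_(0 <= i < n)
    (\int[mu]_(z in crm_domain a (F i)) jump_size z)))%E; last first.
  by apply/funext => n; apply: eq_bigr => i _; exact: crm_tildeE.
have DE : crm_domain a (\bigcup_n F n) = \bigcup_n crm_domain a (F n).
  apply/seteqP; split => [[z x] [/= zx [i _ Fi]]|[z x] [i _ [/= zx Fi]]].
    by exists i.
  by split => //; exists i.
rewrite DE; apply: semi_sigma_additive_nng_induced.
- exact: measurable_jump_size.
- exact: jump_size_ge0.
- by move=> i; exact: measurable_crm_domain.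
- apply/trivIsetP => i j _ _ ij.
  move/trivIsetP : tF => /(_ _ _ I I ij) Fij.
  apply/seteqP; split => // -[z x] [[_ /= Fi] [_ /= Fj]].
  by have : (F i `&` F j) x by []; rewrite Fij.
- by rewrite -DE; exact: measurable_crm_domain.
Qed.


Lemma crm_tilde_lln (A : set X) : measurable A ->
  {ae P0, forall w, (forall a, crm_tilde (N w) a A \is a fin_num) /\
    (fine (crm_tilde (N w) a A) / a @[a --> +oo] --> fine (H A) * tau)}.
Proof.
move=> mA.
have : {ae P0, forall w, forall n : nat, let th : R := 1 + n.+1%:R^-1 in
    (\forall k \near \oo, crm_tilde (N w) (th ^+ k) A \is a fin_num) /\
    (fine (crm_tilde (N w) (th ^+ k) A) / th ^+ k @[k --> \oo] -->
      fine (H A) * tau)}.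
  apply/ae_foralln => n; apply: lln_geometric => //.
  by rewrite ltrDl invr_gt0.
apply: filterS => w Hw; apply: cvg_monotone_interpolation => //.
- by move=> a; exact: crm_tilde_ge0.
- by move=> a b ab; exact: crm_tilde_le.
Qed.

(** If tau were 0, then [s = 0] would hold rho-almost everywhere on []0, +oo[], making this
    half-line null against its infinite mass. *)
Lemma levy_first_moment_gt0 : 0 < tau.
Proof.
have I0 : (0 <= \int[rho]_(s in `]0%R, +oo[) `|s|%:E)%E.
  by apply: integral_ge0 => s _; rewrite lee_fin.
rewrite fine_gt0// (levy_first_moment rho rhoL rho1) andbT lt_neqAle I0 andbT.
apply/eqP => /esym E0.
have [_ _ rhoy] := rhoL.
have mf : measurable_fun ([set` `]0%R, +oo[] : set R) (fun s : R => s%:E).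
  by apply/measurable_EFinP.
have /(ae_eq_integral_abs rho _ mf) : (\int[rho]_(s in `]0%R, +oo[) `|s%:E| = 0)%E.
  exact: E0.
case=> // Z [mZ Z0 sub].
have : (rho [set` `]0%R, +oo[] <= rho Z)%E.
  apply: le_measure; rewrite ?inE// => s s0; apply: sub => /(_ s0) [] /eqP.
  by move: s0; rewrite /= in_itv/= andbT => /gt_eqF ->.
by rewrite rhoy Z0.
Qed.

Lemma hnrmi_lln (A : set X) : measurable A ->
  {ae P0, forall w, fine (hnrmi (N w) a A) @[a --> +oo] --> fine (H A)}.
Proof.
move=> mA.
apply: filterS2 (crm_tilde_lln A mA) (crm_tilde_lln setT measurableT) => w.
move=> [_ cA] [_ cT].
have HT : fine (H setT) = 1 by rewrite probability_setT.
rewrite HT mul1r in cT.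
have t0 := levy_first_moment_gt0.
have -> : fine (H A) = fine (H A) * tau / tau.
  by rewrite -mulrA divff ?mulr1// gt_eqF.
have tn0 : tau != 0 by rewrite gt_eqF.
apply: cvg_trans (cvgM cA (cvgV tn0 cT)).
apply: near_eq_cvg; near=> a.
have a0 : a != 0 by rewrite gt_eqF//; near: a; apply: nbhs_pinfty_gt; exact: num_real.
by rewrite /hnrmi/= invfM invrK mulrACA mulVf// mulr1.
Unshelve. all: by end_near. Qed.

(** The total mass divided by [a] tends to tau, which is positive, so the mass is nonzero for large
    [a]. If it vanishes at some earlier [a], the quotient defining [hnrmi] is 0 on every set. *)
Lemma hnrmi_probability :
  {ae P0, forall w, \forall a \near +oo,
    exists Q : probability X R, forall A, measurable A -> hnrmi (N w) a A = Q A}.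
Proof.
apply: filterS (crm_tilde_lln setT measurableT) => w [fT cT].
have HT : fine (H setT) = 1 by rewrite probability_setT.
rewrite HT mul1r in cT.
have t0 := levy_first_moment_gt0.
have pos : \forall a \near +oo, 0 < fine (crm_tilde (N w) a [set: X]) / a.
  by move/cvgrPdist_lt : cT => /(_ _ t0); apply: filterS => a; rewrite ltr_norml => /andP[_]; lra.
near=> a.
have a0 : 0 < a by near: a; apply: nbhs_pinfty_gt; exact: num_real.
have ca0 : 0 < fine (crm_tilde (N w) a [set: X]) / a by near: a.
have c0 : 0 < fine (crm_tilde (N w) a [set: X]).
  by rewrite pmulr_lgt0 ?invr_gt0 in ca0.
have [nu nuE] := crm_tilde_sig_measure w a.
(* [H] is only the fallback of [mnormalize] for zero or infinite mass, cases excluded here. *)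
exists (mnormalize nu H) => A mA.
rewrite /hnrmi /= /mnormalize nuE//.
rewrite ifF; last first.
  rewrite -[X in (X == 0)%E](fineK (fT a)) eqe gt_eqF//=.
  by rewrite -[X in (X == +oo)%E](fineK (fT a)).
have fA : crm_tilde (N w) a A \is a fin_num.
  rewrite ge0_fin_numE ?crm_tilde_ge0// -nuE//.
  apply: (@le_lt_trans _ _ (nu setT)); first by apply: le_measure; rewrite ?inE.
  by rewrite nuE// -ge0_fin_numE ?crm_tilde_ge0.
by rewrite nuE// EFinM fineK.
Unshelve. all: by end_near. Qed.

End poisson_random_measure.

(** * Convergence of integrals and distribution functions *)

(** The sum is the floor of [y], written as a count of thresholds so that each summand becomes an
    indicator. *)
Lemma sum_indicator_floor {R : realType} (K : nat) (y : R) : 0 <= y <= K%:R ->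
  \sum_(k < K) (k.+1%:R <= y)%R%:R <= y <= \sum_(k < K) (k.+1%:R <= y)%R%:R + 1.
Proof.
elim: K y => [|K IH] y /andP[y0 yK].
  by rewrite big_ord0 y0 add0r (le_trans yK).
rewrite big_ord_recl /=; have [y1|y1] := leP 1 y.
  have /IH : 0 <= y - 1 <= K%:R by rewrite subr_ge0 y1 lerBlDr natr1.
  rewrite (eq_bigr (fun k : 'I_K => (k.+1%:R <= y - 1)%R%:R : R)); last first.
    by move=> k _; rewrite lerBrDr natr1 /bump /=.
  by set s := \sum_(_ < K) _ => /andP[]; rewrite /= => h1 h2; apply/andP; split; lra.
rewrite big1 => [|k _]; first by rewrite addr0 y0 add0r ltW.
by rewrite leNgt (lt_le_trans y1)// ler1n.
Qed.

(** * Integrals of bounded functions through superlevel sets *)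

Section layer_cake.
Context {R : realType} {dX : measure_display} {X : measurableType dX}.
Variables (f : X -> R) (M : nat).
Hypothesis mf : measurable_fun setT f.
Hypothesis fM : forall x, `|f x| <= M%:R.

Definition superlevel (n k : nat) : set X :=
  [set x | k.+1%:R / n.+1%:R <= f x + M%:R].

Lemma measurable_superlevel n k : measurable (superlevel n k).
Proof.
rewrite (_ : superlevel n k = setT `&`
    (fun x => f x + M%:R) @^-1` [set` `[k.+1%:R / n.+1%:R, +oo[]).
  have m : measurable_fun setT (fun x => f x + M%:R) by exact: measurable_funD.
  by apply: m.
by rewrite setTI; apply/seteqP; split => x; rewrite /superlevel/= in_itv/= andbT.
Qed.

(** This is [f + M] rounded down to a multiple of [1 / n.+1]; since [f + M] lies in [[0, 2 * M]],
    [2 * M * n.+1] thresholds suffice. *)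
Let s n x := n.+1%:R^-1 * \sum_(k < 2 * M * n.+1) \1_(superlevel n k) x : R.

Let s_bound n x : s n x <= f x + M%:R <= s n x + n.+1%:R^-1.
Proof.
have n0 : 0 < n.+1%:R :> R by [].
have : 0 <= (f x + M%:R) * n.+1%:R <= (2 * M * n.+1)%:R.
  have := fM x; rewrite ler_norml => /andP[h1 h2].
  rewrite mulr_ge0//=; last by lra.
  by rewrite natrM ler_pM2r// natrM; lra.
move=> /sum_indicator_floor.
rewrite (eq_bigr (fun k : 'I__ => \1_(superlevel n k) x)); last first.
  move=> k _; rewrite indicE /superlevel -ler_pdivrMr//.
  by congr (nat_of_bool _)%:R; apply/idP/idP => [?|]; [rewrite inE|rewrite inE].
rewrite /s; set S := \sum_(_ < _) _ => /andP[h1 h2].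
rewrite ler_pdivrMl// mulrC h1/=.
have : f x + M%:R <= n.+1%:R^-1 * (S + 1) by rewrite ler_pdivlMl// mulrC.
by rewrite mulrDr mulr1.
Qed.

(** The error is the same for every probability [Q], so one [n] serves both [H] and all large
    [a]. *)
Lemma integral_superlevel (Q : probability X R) (n : nat) :
  `| fine (\int[Q]_x (f x)%:E)%E -
     (n.+1%:R^-1 * \sum_(k < 2 * M * n.+1) fine (Q (superlevel n k)) - M%:R) |
  <= n.+1%:R^-1.
Proof.
have n0 : 0 < n.+1%:R :> R by [].
have PT : (Q setT = 1)%E by exact: probability_setT.
have mc c : (\int[Q]_x c%:E = c%:E)%E.
  by rewrite integral_cst// -[RHS]mule1; congr (_ * _)%E; exact: PT.
have fi : Q.-integrable setT (EFin \o f).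
  apply: measurable_bounded_integrable => //.
    by apply: (@le_lt_trans _ _ 1%E); [rewrite -PT|rewrite ltry].
  by exists M%:R; split => // t Mt x _; exact: le_trans (fM x) (ltW Mt).
have ffin := integrable_fin_num measurableT fi.
have msl k : measurable (superlevel n k) := measurable_superlevel n k.
have ms : measurable_fun setT (s n).
  apply: measurable_funM => //; apply: measurable_sum => k.
  exact: measurable_indic.
have s0 x : 0 <= s n x.
  by rewrite mulr_ge0 ?invr_ge0// sumr_ge0.
have IS : (\int[Q]_x (s n x)%:E =
    (n.+1%:R^-1 * \sum_(k < 2 * M * n.+1) fine (Q (superlevel n k)))%:E)%E.
  under eq_integral do rewrite /s EFinM.
  rewrite ge0_integralZl_EFin ?invr_ge0//; last 2 first.
  - by move=> x _; rewrite lee_fin sumr_ge0.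
  - by apply/measurable_EFinP; apply: measurable_sum => k; exact: measurable_indic.
  rewrite EFinM; congr (_ * _)%E; rewrite -sumEFin.
  under eq_integral do rewrite -sumEFin.
  rewrite ge0_integral_sum//; last first.
    by move=> k; apply/measurable_EFinP; exact: measurable_indic.
  apply: eq_bigr => k _; rewrite integral_indic// setIT fineK//.
  exact: fin_num_measure.
have IF : (\int[Q]_x (f x + M%:R)%:E = \int[Q]_x (f x)%:E + M%:R%:E)%E.
  under eq_integral do rewrite EFinD.
  rewrite integralD//= ?mc//.
  by apply: finite_measure_integrable_cst.
have mfM : measurable_fun setT (fun x => (f x + M%:R)%:E).
  by apply/measurable_EFinP; exact: measurable_funD.
have fM0 x : 0 <= f x + M%:R.
  by have /andP[h _] := s_bound n x; rewrite (le_trans (s0 x)).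
have lo : (\int[Q]_x (s n x)%:E <= \int[Q]_x (f x + M%:R)%:E)%E.
  apply: ge0_le_integral => //.
  - by move=> x _; rewrite lee_fin.
  - exact/measurable_EFinP.
  - by move=> x _; rewrite lee_fin; have /andP[] := s_bound n x.
have up : (\int[Q]_x (f x + M%:R)%:E <= \int[Q]_x (s n x)%:E + n.+1%:R^-1%:E)%E.
  rewrite -[in leRHS](mc (n.+1%:R^-1)) -ge0_integralD//; last 2 first.
  - by move=> x _; rewrite lee_fin.
  - exact/measurable_EFinP.
  apply: ge0_le_integral => //.
  - by move=> x _; rewrite lee_fin.
  - by apply: emeasurable_funD => //; exact/measurable_EFinP.
  - by move=> x _; rewrite -EFinD lee_fin; have /andP[] := s_bound n x.
move: lo up; rewrite IF IS -[X in (X + _)%E](fineK ffin) -!EFinD !lee_fin => lo up.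
have : 0 < n.+1%:R^-1 :> R by rewrite invr_gt0.
move: lo up; set u := n.+1%:R^-1; set S := u * _ => lo up u0.
by rewrite ler_norml; apply/andP; split; lra.
Qed.

Lemma cvg_integral_superlevel (m : R -> set X -> \bar R) (H : probability X R) :
  (\forall a \near +oo, exists Q : probability X R,
    forall A, measurable A -> m a A = Q A) ->
  (forall n k, fine (m a (superlevel n k)) @[a --> +oo] -->
    fine (H (superlevel n k))) ->
  fine (\int[m a]_x (f x)%:E)%E @[a --> +oo] --> fine (\int[H]_x (f x)%:E)%E.
Proof.
move=> mQ cm; apply/cvgrPdist_le => e e0.
(* Two discretization errors of [e / 4], for [m a] and for [H], leave [e / 2] for the finite sum
   over superlevel sets. *)
pose n := Num.bound (4 / e).
have ne : n.+1%:R^-1 <= e / 4.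
  rewrite -[leRHS]invrK lef_pV2 ?posrE ?invr_gt0 ?divr_gt0// invfM invrK mulrC.
  apply/ltW; apply: (lt_le_trans (archi_boundP _)); first by rewrite divr_ge0// ltW.
  by rewrite ler_nat.
pose G (mu : set X -> \bar R) :=
  n.+1%:R^-1 * \sum_(k < 2 * M * n.+1) fine (mu (superlevel n k)).
have cG : G (m a) @[a --> +oo] --> G H.
  apply: cvgM; first exact: cvg_cst.
  by apply: cvg_big => //; exact: add_continuous.
near=> a.
have [Q mQa] : exists Q : probability X R, forall A, measurable A -> m a A = Q A.
  by near: a.
have GE : G (m a) = G Q.
  rewrite /G; congr (_ * _); apply: eq_bigr => k _; rewrite mQa//.
  exact: measurable_superlevel.
have Ga : `|G H - G (m a)| <= e / 2.
  by near: a; move/cvgrPdist_le : cG; apply; rewrite divr_gt0.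
rewrite (eq_setfun_integral (m a) Q)//.
have := integral_superlevel Q n; have := integral_superlevel H n.
rewrite -/(G Q) -/(G H) -GE.
rewrite !ler_norml in Ga *.
by move: Ga ne; set u := n.+1%:R^-1 => /andP[? ?] ? /andP[? ?] /andP[? ?]; apply/andP; split; lra.
Unshelve. all: by end_near. Qed.

End layer_cake.

(** * Uniform convergence of distribution functions *)

Section glivenko_cantelli.
Context {R : realType}.
Variable H : probability R R.
Hypothesis H_nonatomic : forall x : R, H [set x] = 0%E.

Let F (mu : set R -> \bar R) (x : R) : R := fine (mu [set` `]-oo, x]]).

Let Ffin (Q : probability R R) (A : set R) : measurable A -> Q A \is a fin_num.
Proof. by move=> mA; exact: fin_num_measure. Qed.

Lemma distr_le (Q : probability R R) x y : x <= y -> F Q x <= F Q y.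
Proof.
move=> xy; rewrite /F fine_le ?Ffin// le_measure ?inE// => z /=.
by rewrite !in_itv/= => /le_trans; apply.
Qed.

Lemma distr_ge0 (Q : probability R R) x : 0 <= F Q x.
Proof. exact: fine_ge0. Qed.

Lemma distr_le1 (Q : probability R R) x : F Q x <= 1.
Proof. by rewrite /F -lee_fin fineK ?Ffin// probability_le1. Qed.

Lemma distr_itv (Q : probability R R) x y : x <= y ->
  F Q y = F Q x + fine (Q [set` `]x, y]]).
Proof.
move=> xy; rewrite /F -fineD ?Ffin//; congr fine.
rewrite -measureU//; last first.
  apply/seteqP; split => // z [/=]; rewrite !in_itv/= => zx /andP[xz _].
  by move: xz; rewrite ltNge zx.
congr (Q _); apply/seteqP; split => z /=; rewrite !in_itv/=.
  by move=> zy; have [zx|xz] := leP z x; [left|right].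
by move=> [zx|/andP[]//]; rewrite (le_trans zx).
Qed.

Lemma small_of_decreasing_null (S : nat -> set R) (e : R) :
  (forall i, measurable (S i)) -> (forall i j, (i <= j)%N -> S j `<=` S i) ->
  H (\bigcap_n S n) = 0%E -> 0 < e -> exists n, fine (H (S n)) < e.
Proof.
move=> mS ndS HS e0.
have : H \o S @ \oo --> H (\bigcap_n S n).
  apply: nonincreasing_cvg_mu => //.
  - by rewrite -ge0_fin_numE// Ffin.
  - exact: bigcap_measurable.
  - by move=> i j ij; apply/subsetPset; exact: ndS.
rewrite HS => /fine_cvgP[_ /cvgrPdist_lt/(_ _ e0)[n _ /(_ n (leqnn n))]] /=.
rewrite sub0r normrN => He; exists n; apply: le_lt_trans He.
exact: ler_norm.
Qed.

(** The intervals [S n] shrink to the null set [[set x]], and increments of the distribution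
    function near [x] are masses of their subintervals. *)
Lemma nonatomic_distr_continuous : continuous (F H).
Proof.
move=> x; apply/cvgrPdist_lt => e e0.
pose S n : set R := [set` `]x - n.+1%:R^-1, x + n.+1%:R^-1]].
have mS i : measurable (S i) by exact: measurable_itv.
have [n Hn] : exists n, fine (H (S n)) < e.
  apply: small_of_decreasing_null => //.
  - move=> i j ij z; rewrite /S/= !in_itv/= => /andP[h1 h2].
    have d : j.+1%:R^-1 <= i.+1%:R^-1 :> R by rewrite lef_pV2 ?posrE// ler_nat.
    move: h1 h2 d; set u := i.+1%:R^-1; set v := j.+1%:R^-1 => h1 h2 d.
    by apply/andP; split; lra.
  - rewrite (_ : \bigcap_n S n = [set x])//; apply/seteqP; split => z /=; last first.
      by move=> -> n _; rewrite /S/= in_itv/= ltrBlDr ltrDl invr_gt0 ltr0n/= lerDl.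
    move=> Sz; apply: contrapT => /eqP zx.
    have d0 : 0 < `|z - x| by rewrite normr_gt0 subr_eq0.
    have := Sz (Num.bound (`|z - x|^-1)) I; rewrite /S/= in_itv/=.
    set m := Num.bound _ => zm.
    have : m.+1%:R^-1 < `|z - x|.
      rewrite -[ltRHS]invrK ltf_pV2 ?posrE ?invr_gt0//.
      by rewrite (lt_le_trans (archi_boundP _)) ?ler_nat// invr_ge0.
    by apply/negP; rewrite -leNgt ler_norml; move: zm; set u := m.+1%:R^-1 => /andP[? ?]; apply/andP; split; lra.
have {n Hn} [v v0 Hn] : exists2 v, 0 < v & fine (H [set` `]x - v, x + v]]) < e.
  by exists n.+1%:R^-1; rewrite ?invr_gt0.
near=> y.
have : `|x - y| < v by near: y; exact: cvgr_dist_lt.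
rewrite ltr_norml => /andP[y1 y2].
apply: le_lt_trans Hn.
have [xy|yx] := leP x y.
  rewrite (distr_itv _ _ _ xy) opprD addNKr normrN ger0_norm; last exact: fine_ge0.
  rewrite fine_le ?Ffin// le_measure ?inE// => z; rewrite /= !in_itv/=.
  by move=> /andP[? ?]; apply/andP; split; lra.
rewrite (distr_itv _ _ _ (ltW yx)) addrC addKr ger0_norm; last exact: fine_ge0.
rewrite fine_le ?Ffin// le_measure ?inE// => z; rewrite /= !in_itv/=.
by move=> /andP[? ?]; apply/andP; split; lra.
Unshelve. all: by end_near. Qed.

(** Both tails of [H] shrink to the empty set, which brackets [u] between two values of the
    distribution function; continuity and the intermediate value theorem do the rest. *)
Lemma nonatomic_quantile (u : R) : 0 < u < 1 -> exists x, F H x = u.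
Proof.
move=> /andP[u0 u1].
have [i Hi] : exists n, F H (- n%:R) < u.
  rewrite /F; apply: (small_of_decreasing_null (fun n => [set` `]-oo, - n%:R]])) => //.
  - move=> i j ij z; rewrite /= !in_itv/= => /le_trans; apply.
    by rewrite lerN2 ler_nat.
  - rewrite (_ : \bigcap_n _ = set0) ?measure0//; apply/seteqP; split => // z.
    move=> /(_ (Num.bound `|z|) I) /=; rewrite in_itv/= leNgt => /negP; apply.
    rewrite ltrNl (le_lt_trans _ (archi_boundP (normr_ge0 z)))//.
    by rewrite -normrN ler_norm.
have [j Hj] : exists n, fine (H [set` `]n%:R, +oo[]) < 1 - u.
  apply: (small_of_decreasing_null (fun n => [set` `]n%:R, +oo[])); last by rewrite subr_gt0.
  - by move=> ?; exact: measurable_itv.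
  - move=> a b ab z; rewrite /= !in_itv/= !andbT; apply: le_lt_trans.
    by rewrite ler_nat.
  - rewrite (_ : \bigcap_n _ = set0) ?measure0//; apply/seteqP; split => // z.
    move=> /(_ (Num.bound `|z|) I) /=; rewrite in_itv/= andbT ltNge => /negP; apply.
    by rewrite ltW// (le_lt_trans (ler_norm z))// archi_boundP.
have Hj' : u < F H j%:R.
  have : F H j%:R + fine (H [set` `]j%:R, +oo[]) = 1.
    rewrite /F -fineD ?Ffin// -measureU//; last first.
      apply/seteqP; split => // z [/=]; rewrite !in_itv/= andbT => zx xz.
      by move: xz; rewrite ltNge zx.
    rewrite (_ : _ `|` _ = setT).
      by apply: (congr1 fine (y := 1%E)); exact: probability_setT.
    apply/seteqP; split => // z _ /=; rewrite !in_itv/= andbT.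
    by have [zx|xz] := leP z j%:R; [left|right].
  by lra.
have ij : - i%:R <= j%:R :> R by rewrite lerNl (le_trans _ (ler0n _ _))// oppr_le0.
have [||c _ cu] := @IVT R (F H) (- i%:R) j%:R u ij.
- by apply: continuous_subspaceT; exact: nonatomic_distr_continuous.
- by rewrite ge_min le_max (ltW Hi) (ltW Hj') orbT.
by exists c.
Qed.

(** The quantiles [xs] are a parameter because they have to be fixed before the almost sure event is
    formed. *)
Lemma glivenko_cantelli_quantile (xs : nat -> nat -> R) (m : R -> set R -> \bar R) :
  (forall n k, (0 < k < n)%N -> F H (xs n k) = k%:R / n%:R) ->
  (\forall a \near +oo, exists Q : probability R R,
    forall A, measurable A -> m a A = Q A) ->
  (forall n k, F (m a) (xs n k) @[a --> +oo] --> F H (xs n k)) ->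
  forall e, 0 < e -> \forall a \near +oo, forall x, `|F (m a) x - F H x| <= e.
Proof.
move=> Fxs mQ cm e e0.
pose n := (Num.bound (4 / e)).+1.
have n0 : 0 < n%:R :> R by [].
have ne : n%:R^-1 <= e / 4.
  rewrite -[leRHS]invrK lef_pV2 ?posrE ?invr_gt0 ?divr_gt0// invfM invrK mulrC.
  apply/ltW; apply: (lt_le_trans (archi_boundP _)); first by rewrite divr_ge0// ltW.
  by rewrite ler_nat.
have allk : \forall a \near +oo, forall k : 'I_n, `|F H (xs n k) - F (m a) (xs n k)| <= e / 4.
  apply: filter_forall => k; move/cvgrPdist_le : (cm n k); apply.
  by rewrite divr_gt0.
near=> a.
have [Q mQa] : exists Q : probability R R, forall A, measurable A -> m a A = Q A.
  by near: a.
have FE x : F (m a) x = F Q x by rewrite /F mQa.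
have close k : (k < n)%N -> `|F H (xs n k) - F Q (xs n k)| <= e / 4.
  move=> kn; rewrite -FE.
  have : forall k : 'I_n, `|F H (xs n k) - F (m a) (xs n k)| <= e / 4 by near: a.
  by move=> /(_ (Ordinal kn)).
move=> x; rewrite FE.
have F0 := distr_ge0 H x; have F1 := distr_le1 H x.
have Q0 := distr_ge0 Q x; have Q1 := distr_le1 Q x.
pose j := truncn (F H x * n%:R).
have /andP[j1 j2] : j%:R <= F H x * n%:R < j.+1%:R.
  by apply: truncn_itv; rewrite mulr_ge0.
(* The quantile of order [(j + 1) / n] lies to the right of [x]. When [n <= j.+1] none is available,
   but then [F H x] is within [1 / n] of 1. *)
have up : F Q x <= F H x + n%:R^-1 + e / 4.
  have [jn|nj] := ltnP j.+1 n; last first.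
    have : (n%:R - 1) / n%:R <= F H x.
      rewrite ler_pdivrMr// (le_trans _ j1)// lerBlDr natr1 ler_nat//.
    rewrite mulrBl divff ?gt_eqF// mul1r.
    by move: e0; set v := n%:R^-1; lra.
  have Fx1 : F H (xs n j.+1) = j.+1%:R / n%:R by exact: Fxs.
  have xx1 : x <= xs n j.+1.
    rewrite leNgt; apply/negP => /ltW /(distr_le H); apply/negP.
    by rewrite -ltNge Fx1 ltr_pdivlMr.
  have := distr_le Q _ _ xx1; have := close _ jn; rewrite ler_norml Fx1.
  have : j.+1%:R / n%:R <= F H x + n%:R^-1.
    by rewrite -natr1 mulrDl mul1r lerD2r ler_pdivrMr.
  by move=> ? /andP[? ?] ?; lra.
(* Order [(j - 1) / n] is used instead of [j / n]: if [F H x = j / n] and [F H] is flat there, the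
   quantile of order [j / n] may lie to the right of [x]. This costs a second [1 / n]; for [j <= 1]
   the left side is at most 0. *)
have lo : F H x - 2 * n%:R^-1 - e / 4 <= F Q x.
  case: j j1 j2 => [|[|j]] j1 j2.
  - have : F H x <= n%:R^-1 by rewrite -[leRHS]mul1r ler_pdivlMr// ltW.
    by move: ne; set v := n%:R^-1; lra.
  - have : F H x <= 2 * n%:R^-1 by rewrite ler_pdivlMr// ltW.
    by lra.
  have jn : (j.+1 < n)%N.
    have : j.+2%:R <= n%:R :> R by rewrite (le_trans j1)// ler_piMl.
    by rewrite ler_nat.
  have Fx1 : F H (xs n j.+1) = j.+1%:R / n%:R by exact: Fxs.
  have xx1 : xs n j.+1 <= x.
    rewrite leNgt; apply/negP => /ltW /(distr_le H); apply/negP.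
    by rewrite -ltNge Fx1 ltr_pdivrMr// (lt_le_trans _ j1)// ltr_nat.
  have := distr_le Q _ _ xx1; have := close _ jn; rewrite ler_norml Fx1.
  have : F H x - 2 * n%:R^-1 <= j.+1%:R / n%:R.
    rewrite lerBlDr -mulrDl ler_pdivlMr// (le_trans (ltW j2))//.
    by rewrite -natrD addn2.
  by move=> ? /andP[? ?] ?; lra.
rewrite ler_norml; move: up lo ne; set v := n%:R^-1 => up lo ne.
by apply/andP; split; lra.
Unshelve. all: by end_near. Qed.

End glivenko_cantelli.

(** * Convergence in the metric [d], and the two conclusions *)

Lemma cvge0_squeeze {R : realType} (D : R -> \bar R) :
  (forall a, (0 <= D a)%E) ->
  (forall e, 0 < e -> \forall a \near +oo, (D a <= e%:E)%E) ->
  D a @[a --> +oo] --> 0%E.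
Proof.
move=> D0 De; apply/fine_cvgP; split.
  apply: filterS (De 1 ltr01) => a Da.
  by rewrite ge0_fin_numE// (le_lt_trans Da)// ltry.
apply/cvgrPdist_le => e e0; apply: filterS (De e e0) => a Da.
have Dfin : D a \is a fin_num by rewrite ge0_fin_numE// (le_lt_trans Da)// ltry.
by rewrite sub0r normrN ger0_norm ?fine_ge0// -lee_fin fineK.
Qed.

Lemma metric_continuous_measurable {R : realType} {dX : measure_display}
    {X : measurableType dX} (eta : X -> X -> R) (f : X -> R) :
  metric_borel eta -> metric_continuous eta f -> measurable_fun setT f.
Proof.
move=> borel cf; apply: (measurability _ (RGenOInfty.measurableE R)).
move=> _ [_ [a ->] <-]; rewrite setTI borel; apply: sub_sigma_algebra.
move=> x /=; rewrite in_itv/= andbT => ax.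
have [|dl dl0 Hdl] := cf x (f x - a); first by rewrite subr_gt0.
exists dl => // y /= /Hdl; rewrite ltr_norml in_itv/= andbT => /andP[_].
by lra.
Qed.

Lemma cvg_dist_d {R : realType} {dX : measure_display} {X : measurableType dX}
    (f : nat -> X -> R) (m : R -> set X -> \bar R) (H : set X -> \bar R) :
  (forall i, fine (\int[m a]_x (f i x)%:E)%E @[a --> +oo] -->
    fine (\int[H]_x (f i x)%:E)%E) ->
  dist_d f (m a) H @[a --> +oo] --> 0%E.
Proof.
move=> cf.
have u0 a i : (0 <= ((2 ^- i.+1 : R) *
    minr `| fine (\int[m a]_x (f i x)%:E) - fine (\int[H]_x (f i x)%:E) | 1)%:E)%E.
  by rewrite lee_fin mulr_ge0 ?invr_ge0 ?exprn_ge0// le_min normr_ge0 ler01.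
apply: cvge0_squeeze => [a|e e0].
  by apply: nneseries_ge0 => i _ _.
(* The first n terms are at most e / 2 * 2^-(i+1); the tail is at most 2^-n. *)
have [n Hn] : exists n, 2 ^- n <= e / 2 :> R.
  have [n _ /(_ n (leqnn n)) Hn] := near_le_expr 2 (2 / e) (ltr1n R 2).
  exists n; rewrite -[leRHS]invrK lef_pV2 ?posrE ?invr_gt0 ?divr_gt0 ?exprn_gt0//.
  by rewrite invfM invrK mulrC.
have near_n : \forall a \near +oo, forall i : 'I_n,
    `| fine (\int[m a]_x (f i x)%:E)%E - fine (\int[H]_x (f i x)%:E)%E | <= e / 2.
  apply: filter_forall => i; move/cvgrPdist_le : (cf i) => /(_ (e / 2)).
  by rewrite divr_gt0// => /(_ isT); apply: filterS => a; rewrite distrC.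
apply: filterS near_n => a Ha.
apply: nneseries_le_bound => // k.
rewrite sumEFin lee_fin.
(* The bound is a closed form: [1 - 2 ^- k] sums [2 ^- i.+1] over [i < k], and the maximum sums it
   over [n <= i < k], which is empty while [k <= n]. *)
suff : \sum_(0 <= i < k) ((2 ^- i.+1 : R) *
    minr `| fine (\int[m a]_x (f i x)%:E)%E - fine (\int[H]_x (f i x)%:E)%E | 1)
    <= e / 2 * (1 - 2 ^- k) + Num.max 0 (2 ^- n - 2 ^- k).
  move=> /le_trans; apply.
  have k0 : 0 < 2 ^- k :> R by rewrite invr_gt0 exprn_gt0.
  have n0 : 0 < 2 ^- n :> R by rewrite invr_gt0 exprn_gt0.
  have : Num.max 0 (2 ^- n - 2 ^- k) <= 2 ^- n :> R.
    by rewrite ge_max (ltW n0) gerBl ltW.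
  have : e / 2 * (1 - 2 ^- k) <= e / 2.
    by rewrite ler_piMr// ?divr_ge0 ?(ltW e0)// gerBl ltW.
  by move: Hn; lra.
elim: k => [|k IH].
  by rewrite big_geq// expr0 invr1 subrr mulr0 add0r le_max lexx.
rewrite big_nat_recr//=; set w := minr _ _; set s := \sum_(_ <= _ < _) _ in IH *.
have half : 2 ^- k = 2 * 2 ^- k.+1 :> R.
  by rewrite exprS invfM mulrA divff ?mul1r.
have k0 : 0 < 2 ^- k.+1 :> R by rewrite invr_gt0 exprn_gt0.
have w1 : w <= 1 by rewrite ge_min lexx orbT.
rewrite half in IH; set q := 2 ^- k.+1 in IH k0 *; move: IH.
have [kn|nk] := ltnP k n.
  have we : w <= e / 2 by rewrite ge_min (Ha (Ordinal kn)).
  have qw : q * w <= q * (e / 2) by rewrite ler_pM2l.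
  have le_kn : 2 ^- n <= q.
    by rewrite /q lef_pV2 ?posrE ?exprn_gt0// ler_weXn2l// ler1n.
  have -> : Num.max 0 (2 ^- n - 2 * q) = 0 by apply/max_idPl; lra.
  have -> : Num.max 0 (2 ^- n - q) = 0 by apply/max_idPl; lra.
  by lra.
have le_nk : 2 * q <= 2 ^- n.
  by rewrite /q -half lef_pV2 ?posrE ?exprn_gt0// ler_weXn2l// ler1n.
have -> : Num.max 0 (2 ^- n - 2 * q) = 2 ^- n - 2 * q by apply/max_idPr; lra.
have -> : Num.max 0 (2 ^- n - q) = 2 ^- n - q by apply/max_idPr; lra.
have qw : q * w <= q by rewrite ler_piMr// ltW.
have eq0 : 0 <= e / 2 * q by rewrite mulr_ge0// ?divr_ge0// ltW.
by lra.
Qed.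

Theorem theorem1 (R : realType) :
  (* (i) strong law of large numbers *)
  (forall (dO : measure_display) (Omega : measurableType dO)
          (P0 : probability Omega R)
          (dX : measure_display) (X : measurableType dX) (eta : X -> X -> R)
          (rho : {measure set R -> \bar R}) (H : probability X R)
          (N : Omega -> set (R * R * X) -> \bar R) (f : nat -> X -> R),
      is_metric eta -> metric_complete eta -> metric_separable eta ->
      metric_borel eta ->
      levy_rho rho ->
      (forall x : X, H [set x] = 0%E) ->
      is_poisson_random_measure P0 N (prm_mean rho H) ->
      (\int[rho]_(s in `[1%R, +oo[) s%:E < +oo)%E ->
      (forall i, metric_continuous eta (f i) /\ bounded_real_fun (f i)) ->
      {ae P0, forall w,
        dist_d f (hnrmi (N w) a) H @[a --> +oo] --> 0%E})
  /\
  (* (ii) Glivenko-Cantelli, X = R with its Borel sigma-algebra *)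
  (forall (dO : measure_display) (Omega : measurableType dO)
          (P0 : probability Omega R)
          (rho : {measure set R -> \bar R}) (H : probability R R)
          (N : Omega -> set (R * R * R) -> \bar R),
      levy_rho rho ->
      (forall x : R, H [set x] = 0%E) ->
      is_poisson_random_measure P0 N (prm_mean rho H) ->
      (\int[rho]_(s in `[1%R, +oo[) s%:E < +oo)%E ->
      {ae P0, forall w,
        ereal_sup [set (`| fine (hnrmi (N w) a [set` `]-oo, x]])
                          - fine (H [set` `]-oo, x]]) |)%:E | x in [set: R]]
          @[a --> +oo] --> 0%E}).
Proof.
split=> [dO Omega P0 dX X eta rho H N f _ _ _ borel rhoL _ prmN rho1 fP|
  dO Omega P0 rho H N rhoL Hna prmN rho1].
  have mf i : measurable_fun setT (f i).
    by have [cf _] := fP i; exact: metric_continuous_measurable cf.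
  have /choice[M fM] : forall i, exists M : nat, forall x, `|f i x| <= M%:R.
    move=> i; have [_ [M fM]] := fP i; exists (Num.bound `|M|) => x.
    by rewrite (le_trans (fM x))// (le_trans (ler_norm M))// ltW// archi_boundP.
  have lln : {ae P0, forall w, forall i n k,
      fine (hnrmi (N w) a (superlevel (f i) (M i) n k)) @[a --> +oo] -->
      fine (H (superlevel (f i) (M i) n k))}.
    apply/ae_foralln => i; apply/ae_foralln => n; apply/ae_foralln => k.
    by apply: (hnrmi_lln P0 rho H N rhoL rho1 prmN); exact: measurable_superlevel.
  apply: filterS2 lln (hnrmi_probability P0 rho H N rhoL rho1 prmN) => w lln Q.
  apply: cvg_dist_d => i.
  exact: (cvg_integral_superlevel (f i) (M i) (mf i) (fM i) _ _ Q (lln i)).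
(* The quantiles are chosen independently of [w] and of the precision, so the exceptional set is a
   countable union; indices outside [0 < k < n] receive the dummy point 0. *)
have /choice[xs xsP] : forall n, exists xn : nat -> R, forall k, (0 < k < n)%N ->
    fine (H [set` `]-oo, xn k]]) = k%:R / n%:R.
  move=> n.
  have /choice[xn xnE] : forall k, exists x : R, (0 < k < n)%N ->
      fine (H [set` `]-oo, x]]) = k%:R / n%:R; last by exists xn.
  move=> k; have [/andP[k0 kn]|_] := boolP (0 < k < n)%N; last by exists 0.
  have n0 : 0 < n%:R :> R by rewrite ltr0n (leq_trans _ kn).
  have [|x xE] := nonatomic_quantile H Hna (k%:R / n%:R); last by exists x.
  apply/andP; split; first by rewrite divr_gt0// ltr0n.
  by rewrite ltr_pdivrMr// mul1r ltr_nat.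
have lln : {ae P0, forall w, forall n k,
    fine (hnrmi (N w) a [set` `]-oo, xs n k]]) @[a --> +oo] -->
    fine (H [set` `]-oo, xs n k]])}.
  apply/ae_foralln => n; apply/ae_foralln => k.
  exact: (hnrmi_lln P0 rho H N rhoL rho1 prmN).
apply: filterS2 lln (hnrmi_probability P0 rho H N rhoL rho1 prmN) => w lln Q.
apply: cvge0_squeeze => [a|e e0].
  apply: le_trans (ereal_sup_ubound _); last by exists 0.
  by rewrite lee_fin.
apply: filterS (glivenko_cantelli_quantile H xs _ xsP Q lln e e0) => a Ha.
by apply: ge_ereal_sup => _ [x _ <-]; rewrite lee_fin.
Qed.
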